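(* Let $U\cong\mathbb{R}^d$ be a real vector space of dimension $d\ge 1$, let $\Lambda\subseteq U$ be a lattice with lattice basis $s_1,\dots,s_d$ (so that $\mathrm{Sym}(U)\cong\mathbb{R}[s_1,\dots,s_d]$), let $X=(x_1,\dots,x_N)\subseteq\Lambda$ be a finite list of vectors that spans $U$ and is totally unimodular with respect to $\Lambda$, and let $p\in\mathcal{P}_-(X)$. Then $p(D)B_X$ is a continuous function on $U$, i.e. the distribution obtained by applying $p(D)$ to the box spline $B_X$ is represented by a continuous function.
   Context: Lists may contain repeated vectors and zero vectors; sublists and deletions are taken with multiplicity. The list $X$ is totally unimodular with respect to $\Lambda$ if every basis of $U$ that can be selected from $X$ is also a lattice basis of $\Lambda$. Using the lattice basis, $X$ is identified with a $(d\times N)$ matrix. Box spline: $B_X:U\to\mathbb{R}$, $B_X(u)=\frac{1}{\sqrt{\det(XX^T)}}\,\mathrm{vol}_{N-d}\{(\lambda_1,\dots,\lambda_N)\in[0,1]^N:\sum_i\lambda_ix_i=u\}$, where $\mathrm{vol}_{N-d}$ is $(N-d)$-dimensional Euclidean volume in $\mathbb{R}^N$. Equivalently, as a distribution, $\int_U\varphi(u)B_X(u)\,du=\int_0^1\cdots\int_0^1\varphi(\sum_i\lambda_ix_i)\,d\lambda_1\cdots d\lambda_N$ for test functions $\varphi$. $\mathcal{P}$-spaces: for $u\in U$, $p_u\in\mathrm{Sym}(U)$ is $u$ regarded as a homogeneous element of degree 1; for a list $Y$, $p_Y=\prod_{y\in Y}p_y$ (and $p_\emptyset=1$). For a finite list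 $W$ of vectors in $U$, the central space is $\mathcal{P}(W)=\mathrm{span}\{p_Y: Y\subseteq W,\ \mathrm{rk}(W\setminus Y)=\dim U\}\subseteq\mathrm{Sym}(U)$ (so $\mathcal{P}(W)=\{0\}$ if $W$ does not span $U$). The internal space is $\mathcal{P}_-(X)=\bigcap_{x\in X}\mathcal{P}(X\setminus x)$, where $X\setminus x$ is $X$ with one occurrence of $x$ removed. For $p\in\mathbb{R}[s_1,\dots,s_d]$, $p(D)$ is the differential operator obtained by replacing $s_i$ by $\frac{\partial}{\partial s_i}$ (so $p_u(D)=D_u$ is the directional derivative in direction $u$). *)

(* Defs.v *)
From HB Require Import structures.
From mathcomp Require Import all_boot all_order all_algebra.
From mathcomp Require Import all_classical all_reals all_analysis.
(* The notations of mpoly clash with those of MathComp-Analysis. *)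
From mathcomp Require Import -(notations) mpoly.

Set Implicit Arguments.
Unset Strict Implicit.
Unset Printing Implicit Defensive.

Import Order.TTheory GRing.Theory Num.Theory.
Import numFieldNormedType.Exports.

Local Open Scope classical_set_scope.
Local Open Scope ring_scope.

Definition linear_span (R : pzRingType) (V : lmodType R) (S : set V) : set V :=
  [set v | exists (n : nat) (c : 'I_n -> R) (g : 'I_n -> V),
     (forall i, S (g i)) /\ v = \sum_(i < n) c i *: g i].

Section Lattice.
Variables (R : realType) (d : nat).
Local Notation U := 'rV[R]_d.

Definition lattice_basis (L : set U) (b : d.-tuple U) : Prop :=
  basis_of {:U} b /\
  L = range (fun z : 'I_d -> int => \sum_(i < d) tnth b i *~ z i).

Definition totally_unimodular (L : set U) (X : seq U) : Prop :=
  forall b : d.-tuple U, subseq b X -> basis_of {:U} b -> lattice_basis L b.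

End Lattice.

(* Sym(U) is identified with R[s_1, ..., s_d] through the basis s of U: the
   vector s_i is the i-th variable. *)
Section PSpaces.
Variables (R : realType) (d : nat) (s : d.-tuple 'rV[R]_d).
Local Notation U := 'rV[R]_d.

Definition sym_vec (u : U) : mpoly d R :=
  \sum_(i < d) coord s i u *: mpolyX R (mnm1 i).

Definition sym_list (Y : seq U) : mpoly d R := \prod_(y <- Y) sym_vec y.

(* A sublist Y of W is given by a mask m; the complementary mask gives W \ Y. *)
Definition central_space (W : seq U) : set (mpoly d R) :=
  linear_span [set sym_list (mask m W) | m in
    [set m : bitseq | size m = size W /\
                      \dim <<mask (map negb m) W>>%VS = \dim {:U}]].

Definition internal_space (X : seq U) : set (mpoly d R) :=
  [set p | forall x, x \in X -> central_space (rem x X) p].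

End PSpaces.

Section Distributions.
Variables (R : realType) (d : nat).
Local Notation U := 'rV[R]_d.

Definition smooth (phi : U -> R) : Prop :=
  forall (vs : seq U) (x : U),
    differentiable (foldr (fun v f => 'D_v f) phi vs) x.

Definition test_function (phi : U -> R) : Prop :=
  smooth phi /\ compact (closure [set x | phi x != 0]).

(* The iterated Lebesgue integral of g (u + t_1 v_1 + ... + t_n v_n) for t_1,
   ..., t_n in D.  It is only used where g is continuous and either D is bounded
   or g has compact support and the v_i form a basis, so that by Fubini it is
   the n-dimensional integral over D^n. *)
Fixpoint iterated_integral (D : set R) (vs : seq U) (g : U -> R) (u : U) : R :=
  if vs is v :: vs' then
    \int[lebesgue_measure]_(t in D) iterated_integral D vs' g (u + t *: v)
  else g u.

(* The Lebesgue measure du on U is normalized by the basis s, i.e., it is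
   the Lebesgue measure of the coordinates in s. *)
Definition integral_over (s : d.-tuple U) (g : U -> R) : R :=
  iterated_integral setT s g 0.

(* Distributions are represented by functionals; only their values on test
   functions are relevant. *)
Definition functional := (U -> R) -> R.

(* The box spline B_X, as the distribution
   phi |-> \int_0^1 ... \int_0^1 phi (\sum_i l_i x_i) dl_1 ... dl_N. *)
Definition box_spline (X : seq U) : functional :=
  fun phi => iterated_integral `[0, 1] X phi 0.

Definition distr_derive (v : U) (T : functional) : functional :=
  fun phi => - T ('D_v phi).

(* p(D) T: each variable s_i of p is replaced by the derivative along s_i. *)
Definition distr_diffop (s : d.-tuple U) (p : mpoly d R) (T : functional) :
    functional :=
  fun phi => \sum_(m <- msupp p) mcoeff m p *
    foldr (fun i S => iter (m i) (distr_derive (tnth s i)) S) T (enum 'I_d) phi.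

Definition represented_by (s : d.-tuple U) (T : functional) (f : U -> R) : Prop :=
  forall phi, test_function phi -> T phi = integral_over s (fun u => phi u * f u).

End Distributions.

(* Main.v *)
(* For x in X, p lies in P(X \ x), so p(D) B_X is a combination of translates of
   box splines B_(x :: Z) with Z spanning U. Since B_(x :: Z) is the average of
   B_Z over the segment [0, x] and B_Z is bounded, p(D) B_X is Lipschitz in the
   direction x. As X spans U, p(D) B_X is Lipschitz in all directions. To get
   actual functions out of distributions, p(D) B_X is tested against mollifiers
   of scale h: this gives functions of their centre that are Lipschitz uniformly
   in h, and they converge as h tends to 0. *)
Require Import Defs.
From HB Require Import structures.
From mathcomp Require Import all_boot all_order all_algebra.
From mathcomp Require Import all_classical all_reals all_analysis.
From mathcomp Require Import -(notations) mpoly.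
From mathcomp Require Import ring lra.

Set Implicit Arguments.
Unset Strict Implicit.
Unset Printing Implicit Defensive.

Import Order.TTheory GRing.Theory Num.Theory.
Import numFieldNormedType.Exports.

Local Open Scope classical_set_scope.
Local Open Scope ring_scope.

(** * Integrals of continuous functions on intervals *)

Section OneDim.
Variable R : realType.
Local Notation mu := (@lebesgue_measure R).
Implicit Types (f g : R -> R) (a b c k : R).

(** Every integral is brought to an iterated integral of a continuous function over compact
    intervals. Substitution, Fubini and differentiation under the integral sign then all follow from
    the fundamental theorem of calculus, and a parameter (scale or centre) is treated as one more
    coordinate of a product space.

    The boundedness of B_Z enters only through its pairing with a function of size h^-d supported in
    a cube of side 2h: d of the segments of Z form a basis, each contributes a window of length
    O(h), and the powers of h cancel.

    The combination of box splines obtained from x in X depends on x. All of them agree on smooth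
    functions, since they are the same functional p(D) B_X; this lets the bounds in the different
    directions be combined. *)

Lemma continuous_itv_integrable f a b : continuous f ->
  mu.-integrable `[a, b] (EFin \o f).
Proof.
move=> cf; apply: continuous_compact_integrable; first exact: segment_compact.
exact: continuous_subspaceT.
Qed.

Lemma Rintegral_FTC2 f g a b : a <= b -> continuous g ->
  (forall x, x \in `[a, b] -> is_derive x 1 f (g x)) ->
  \int[mu]_(t in `[a, b]) g t = f b - f a.
Proof.
rewrite le_eqVlt => /predU1P[->|ab] cg df.
  by rewrite set_itv1 Rintegral_set1 subrr.
have cf x : x \in `[a, b] -> {for x, continuous f}.
  move=> xab; apply/differentiable_continuous/derivable1_diffP.
  by have [] := df x xab.
rewrite /Rintegral (@continuous_FTC2 _ g f)//.
- exact: continuous_subspaceT.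
- split.
  + by move=> x xab; have [] := df x (subset_itv_oo_cc xab).
  + by apply: cvg_at_right_filter; apply: cf; rewrite in_itv/= lexx ltW.
  + by apply: cvg_at_left_filter; apply: cf; rewrite in_itv/= lexx ltW.
- move=> x xab; rewrite derive1E.
  by have [_ ->] := df x (subset_itv_oo_cc xab).
Qed.

Lemma continuous_has_primitive f a b : continuous f ->
  exists F, forall x, x \in `[a, b] -> is_derive x 1 F (f x).
Proof.
(* Starting at [a - 1], with [b + 1] as right end below, makes each point of [[a, b]] interior, so
   the derivative is two-sided even at [a] and [b]. *)
move=> cf; exists (fun x => \int[mu]_(t in `[a - 1, x]) f t) => x.
rewrite in_itv/= => /andP[ax xb].
have [| | | | dF F'] := @continuous_FTC1_closed R f (a - 1) x (b + 1).
- by rewrite (le_lt_trans xb)// ltrDl.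
- exact: continuous_itv_integrable.
- by rewrite (lt_le_trans _ ax)// gtrBl.
- exact: cf.
- by apply: DeriveDef; [exact: dF|rewrite -derive1E; exact: F'].
Qed.

Lemma is_derive_affine f c k x l : is_derive (c + k * x) 1 f l ->
  is_derive x 1 (fun t => f (c + k * t)) (k * l).
Proof.
move=> df.
have dg : is_derive x (1 : R) (fun t => c + k * t) k.
  rewrite (_ : (fun t => _) = cst c + k *: (id : R -> R)); last exact/funext.
  have := @is_deriveD _ _ _ _ _ x 1 _ _ (@is_derive_cst _ _ _ c x 1)
    (@is_deriveZ _ _ _ _ k x 1 _ (@is_derive_id _ _ x 1)).
  by rewrite add0r scaler1.
have := @is_derive1_comp _ f _ x _ _ df dg.
by rewrite mulrC.
Qed.

(** If F is a primitive of f, then t |-> F (c + k t) is a primitive of k f (c + k t), and both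
    integrals are the same increment of F. *)
Lemma Rintegral_affine f a b c k : continuous f -> a <= b -> 0 < k ->
  \int[mu]_(t in `[c + k * a, c + k * b]) f t =
  k * \int[mu]_(t in `[a, b]) f (c + k * t).
Proof.
move=> cf ab k0.
have [F dF] := continuous_has_primitive (c + k * a) (c + k * b) cf.
have cg : continuous (fun t => f (c + k * t)).
  move=> t; apply: (@continuous_comp _ _ _ (fun t => c + k * t) f);
    last exact: cf.
  by apply: cvgD; [exact: cvg_cst|apply: cvgMr; exact: cvg_id].
rewrite (Rintegral_FTC2 _ cf dF); last by rewrite lerD2l ler_pM2l.
have cg' : continuous (fun t => k * f (c + k * t)).
  by move=> t; apply: cvgMr; exact: cg.
have dG x : x \in `[a, b] ->
    is_derive x 1 (fun t => F (c + k * t)) (k * f (c + k * x)).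
  rewrite in_itv/= => /andP[ax xb].
  apply: is_derive_affine; apply: dF; rewrite in_itv/=.
  by rewrite !lerD2l !ler_pM2l// ax.
rewrite -(Rintegral_FTC2 ab cg' dG) RintegralZl; [by []|by []|].
exact: continuous_itv_integrable.
Qed.

Lemma Rintegral_itv_cst a b c : a <= b ->
  \int[mu]_(t in `[a, b]) c = c * (b - a).
Proof.
move=> ab; rewrite Rintegral_cst//= lebesgue_measure_itv/= lte_fin.
move: ab; rewrite le_eqVlt => /predU1P[->|->]; last by [].
by rewrite ltxx subrr.
Qed.

Lemma Rintegral_itv_bound f a b c : a <= b -> continuous f ->
  (forall t, t \in `[a, b] -> `|f t| <= c) ->
  `|\int[mu]_(t in `[a, b]) f t| <= c * (b - a).
Proof.
move=> ab cf fc; apply: (le_trans (le_normr_Rintegral _ _)); first by [].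
  exact: (continuous_itv_integrable a b cf).
rewrite -(Rintegral_itv_cst c ab); apply: le_Rintegral; [by []| | |exact: fc].
- apply: (@continuous_itv_integrable (fun t => `|f t|)).
  by move=> t; apply: cvg_norm; exact: cf.
- by apply: (@continuous_itv_integrable (fun t => c)); exact: cst_continuous.
Qed.

End OneDim.

(** * Integrals along segments *)

Section ContinuousFunctions.
Variables (R : realType) (T : topologicalType).

Lemma continuous_fun_comp (S S' : topologicalType) (f : S -> S') (g : T -> S) :
  continuous f -> continuous g -> continuous (fun x => f (g x)).
Proof. by move=> cf cg x; apply: (@continuous_comp _ _ _ g f);
  [exact: cg|exact: cf]. Qed.

Lemma continuous_fun_pair (S S' : topologicalType) (f : T -> S) (g : T -> S') :
  continuous f -> continuous g -> continuous (fun x => (f x, g x)).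
Proof.
move=> cf cg x.
exact: (@cvg_pair _ _ _ (nbhs x) (nbhs (f x)) (nbhs (g x)) _ _ _ f g (cf x)
  (cg x)).
Qed.

Variable V : normedModType R.

Lemma continuous_funD (f g : T -> V) : continuous f -> continuous g ->
  continuous (fun x => f x + g x).
Proof. by move=> cf cg x; apply: cvgD; [exact: cf|exact: cg]. Qed.

Lemma continuous_funB (f g : T -> V) : continuous f -> continuous g ->
  continuous (fun x => f x - g x).
Proof. by move=> cf cg x; apply: cvgB; [exact: cf|exact: cg]. Qed.

Lemma continuous_funZ (f : T -> R) (g : T -> V) : continuous f ->
  continuous g -> continuous (fun x => f x *: g x).
Proof. by move=> cf cg x; apply: cvgZ; [exact: cf|exact: cg]. Qed.

Lemma continuous_funM (f g : T -> R) : continuous f -> continuous g ->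
  continuous (fun x => f x * g x).
Proof. by move=> cf cg x; apply: cvgM; [exact: cf|exact: cg]. Qed.

Lemma continuous_fun_id : continuous (fun x : T => x).
Proof. by move=> x; exact: cvg_id. Qed.

Lemma continuous_fun_sum (I : Type) (r : seq I) (f : I -> T -> V) :
  (forall i, continuous (f i)) -> continuous (fun x => \sum_(i <- r) f i x).
Proof.
move=> cf; elim: r => [|i r IH].
  rewrite (_ : (fun x => _) = fun=> 0); first exact: cst_continuous.
  by apply/funext => x; rewrite big_nil.
rewrite (_ : (fun x => _) = fun x => f i x + \sum_(j <- r) f j x).
  exact: continuous_funD.
by apply/funext => x; rewrite big_cons.
Qed.

End ContinuousFunctions.

Lemma continuous_translate (R : realType) (V : normedModType R) (g : V -> R)
    (w : V) : continuous g -> continuous (fun u => g (u + w)).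
Proof.
move=> cg; apply: (@continuous_fun_comp _ _ _ g (fun u => u + w) cg).
by apply: continuous_funD; [exact: continuous_fun_id|exact: cst_continuous].
Qed.

Section SegmentIntegral.
Variable R : realType.
Local Notation mu := (@lebesgue_measure R).
Implicit Types (V : normedModType R) (a b c d k : R).

Definition segint V a b (v : V) (g : V -> R) (u : V) : R :=
  \int[mu]_(t in `[a, b]) g (u + t *: v).

Lemma continuous_line V (g : V -> R) (u v : V) : continuous g ->
  continuous (fun t : R => g (u + t *: v)).
Proof.
move=> cg t; apply: (@continuous_comp _ _ _ (fun t : R => u + t *: v) g).
  by apply: cvgD; [exact: cvg_cst|apply: cvgZr_tmp; exact: cvg_id].
exact: cg.
Qed.

Lemma segint_continuous V a b (v : V) (g : V -> R) : continuous g ->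
  continuous (segint a b v g).
Proof.
move=> cg u.
have [ab|ba] := leP a b; last first.
  rewrite /segint set_itv_ge -?ltNge//.
  by under [X in continuous_at _ X]eq_fun do rewrite Rintegral_set0;
    exact: cst_continuous.
apply/cvgrPdist_le => /= e e0.
(* The added 1 keeps the denominator positive when [a = b]. *)
pose e' := e / (b - a + 1).
have ba1 : 0 < b - a + 1 by rewrite ltr_wpDl ?subr_ge0.
have e'0 : 0 < e' by rewrite divr_gt0.
(* Compactness of [[a, b]] makes the estimate uniform in [t]. *)
have : \forall u' \near u, `[a, b] `<=`
    [set t | `|g (u + t *: v) - g (u' + t *: v)| <= e'].
  have /compact_near_coveringP := @segment_compact R a b.
  apply => t _.
  have h1 : (fun x : R * V => x.2 + x.1 *: v) @ (t, u) --> u + t *: v.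
    apply: cvgD; first exact: cvg_snd.
    by apply: cvgZr_tmp; exact: cvg_fst.
  have h2 : (fun x : R * V => u + x.1 *: v) @ (t, u) --> u + t *: v.
    apply: cvgD; first exact: cvg_cst.
    by apply: cvgZr_tmp; exact: cvg_fst.
  have h : (fun x : R * V => g (u + x.1 *: v) - g (x.2 + x.1 *: v)) @ (t, u)
      --> (0 : R).
    rewrite -(subrr (g (u + t *: v))); apply: cvgB.
      exact: (cvg_comp _ _ h2 (cg _)).
    exact: (cvg_comp _ _ h1 (cg _)).
  move/cvgrPdist_le : h => /(_ _ e'0).
  by apply: filterS => -[x y] /=; rewrite sub0r normrN.
apply: filterS => u' H; rewrite /segint -RintegralB//; last 2 first.
- by apply: continuous_itv_integrable; exact: continuous_line.
- by apply: continuous_itv_integrable; exact: continuous_line.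
apply: (@le_trans _ _ (e' * (b - a))).
  apply: Rintegral_itv_bound => //.
  by move=> t; apply: cvgB; exact: continuous_line.
by rewrite /e' mulrAC ler_pdivrMr// ler_pM2l// lerDl.
Qed.

(** The integral over t is a segment integral in V * R along (0, 1), so this is an instance of
    [segint_continuous]. *)
Lemma continuous_Rintegral_param V a b (f : V -> R -> R) :
  continuous (fun x : V * R => f x.1 x.2) ->
  continuous (fun u => \int[mu]_(t in `[a, b]) f u t).
Proof.
move=> cf.
have h := @segint_continuous _ a b (0 : V, 1 : R) (fun x => f x.1 x.2) cf.
rewrite (_ : (fun u => _) = segint a b (0 : V, 1 : R) (fun x => f x.1 x.2) \o
    (fun u : V => (u, 0 : R))).
  apply: continuous_fun_comp => //.
  apply: continuous_fun_pair; [exact: continuous_fun_id|exact: cst_continuous].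
apply/funext => w /=; apply: eq_Rintegral => t _ /=.
by rewrite scaler0 addr0 add0r [_ *: _]mulr1.
Qed.

Lemma segint_shift V a b (v w u : V) (g : V -> R) :
  segint a b v (fun x => g (x + w)) u = segint a b v g (u + w).
Proof. by apply: eq_Rintegral => t _; rewrite addrAC. Qed.

Lemma segint_affine V (a b c k : R) (v u : V) (g : V -> R) : continuous g ->
  a <= b -> 0 < k ->
  segint (c + k * a) (c + k * b) v g u = k * segint a b (k *: v) g (u + c *: v).
Proof.
move=> cg ab k0; rewrite /segint.
rewrite (Rintegral_affine c (@continuous_line _ g u v cg) ab k0); congr (_ * _).
apply: eq_Rintegral => t _.
by rewrite scalerDl addrA (mulrC k) scalerA.
Qed.

(* The oriented integral of g over the segment from u to u + x *: v, for x of
   either sign. *)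
Let prim V (v : V) (g : V -> R) (x : R) (u : V) : R :=
    x * segint 0 1 (x *: v) g u.

Let is_derive_prim V (v : V) (g : V -> R) (x : R) (u : V) : continuous g ->
  is_derive x 1 (prim v g ^~ u) (g (u + x *: v)).
Proof.
move=> cg.
pose h t := g (u + t *: v).
have ch : continuous h by exact: continuous_line.
(* The radius [|x| + 1] leaves room for every [y] near [x], of either sign, together with the
   segment from 0 to [y]. *)
have [F dF] := continuous_has_primitive (- (`|x| + 1)) (`|x| + 1) ch.
have x1 : 0 <= `|x| + 1 by rewrite addr_ge0.
have primE y : `|y| <= `|x| + 1 -> prim v g y u = F y - F 0.
  move=> yx.
  have dG (t : R) : t \in `[0, 1] -> is_derive t 1 (fun t => F (0 + y * t))
      (y * h (0 + y * t)).
    rewrite in_itv/= => /andP[t0 t1]; apply: is_derive_affine; apply: dF.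
    rewrite in_itv/= add0r -ler_norml normrM (ger0_norm t0).
    by rewrite (le_trans _ yx)// ler_piMr.
  have cy : continuous (fun t => h (0 + y * t)).
    move=> t; apply: (@continuous_comp _ _ _ (fun t => 0 + y * t) h);
      last exact: ch.
    by apply: cvgD; [exact: cvg_cst|apply: cvgMr; exact: cvg_id].
  have cy' : continuous (fun t => y * h (0 + y * t)).
    by move=> t; apply: cvgMr; exact: cy.
  have := Rintegral_FTC2 (@ler01 R) cy' dG.
  rewrite RintegralZl; [|by []|exact: continuous_itv_integrable].
  rewrite !add0r mulr1 mulr0 => <-; congr (_ * _).
  by apply: eq_Rintegral => t _; rewrite /h add0r scalerA mulrC.
have xI : x \in `[- (`|x| + 1), `|x| + 1].
  by rewrite in_itv/= -ler_norml lerDl.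
have dF' : is_derive x 1 (fun y => F y - F 0) (h x).
  have := @is_deriveB _ _ _ _ _ x 1 _ _ (dF x xI) (@is_derive_cst _ _ _ (F 0) x
    1).
  by rewrite subr0.
apply: (near_eq_is_derive _ dF').
have nx : \forall y \near x, `|x - y| <= 1.
  by have /cvgrPdist_le := @cvg_id _ (nbhs x); apply.
near=> y; apply/esym/primE.
have -> : y = x + (y - x) by rewrite addrC subrK.
rewrite (le_trans (ler_normD _ _))// lerD2l distrC.
by near: y.
Unshelve. all: end_near. Qed.

Let prim_continuous V (v : V) (g : V -> R) (x : R) : continuous g ->
  continuous (prim v g x).
Proof.
move=> cg; apply: continuous_funM; first exact: cst_continuous.
exact: segint_continuous.
Qed.

Let segint_prim V a b (v : V) (g : V -> R) (u : V) : continuous g -> a <= b ->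
  segint a b v g u = prim v g b u - prim v g a u.
Proof.
move=> cg ab; rewrite /segint.
have h (x : R) : x \in `[a, b] ->
  is_derive x 1 (prim v g ^~ u) (g (u + x *: v)).
  by move=> _; exact: is_derive_prim.
have := Rintegral_FTC2 ab (@continuous_line _ g u v cg) h.
exact.
Qed.

(** As functions of h, both sides vanish at 0 and have the same derivative. *)
Let primD V (v : V) (g : V -> R) (x h : R) (u : V) : continuous g ->
  prim v g (x + h) u - prim v g x u = prim v g h (u + x *: v).
Proof.
move=> cg; apply/eqP; rewrite -subr_eq0; apply/eqP.
pose k y := prim v g (x + y) u - prim v g x u - prim v g y (u + x *: v).
suff dk (y : R) : is_derive y 1 k 0.
  rewrite -[LHS]/(k h) (is_derive_0_is_cst h 0 dk) /k addr0 subrr.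
  by rewrite /prim mul0r subrr.
have d1 : is_derive y 1 (fun y => prim v g (x + y) u) (g (u + (x + y) *: v)).
  have := @is_derive_affine R (prim v g ^~ u) x 1 y (g (u + (x + y) *: v)).
  rewrite !mul1r => /(_ (is_derive_prim _ _ _ cg)).
  by under [X in is_derive _ _ X _ -> _]eq_fun do rewrite mul1r.
have d2 := @is_derive_prim _ v g y (u + x *: v) cg.
have := @is_deriveB _ _ _ _ _ y 1 _ _
  (@is_deriveB _ _ _ _ _ y 1 _ _ d1 (@is_derive_cst _ _ _ (prim v g x u) y 1))
  d2.
by rewrite subr0 scalerDl addrA subrr.
Qed.

(** By [primD] the difference quotient at step h equals [K h] exactly, and [K] is given by a formula
    without division by h that is continuous at h = 0. Its limit is therefore [K 0], with no
    domination argument. *)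
Let segint_prim_derive V c d (v w : V) (g : V -> R) (x : R) (u : V) :
    continuous g ->
  c <= d ->
  is_derive x 1 (fun x => segint c d w (prim v g x) u)
    (segint c d w g (u + x *: v)).
Proof.
move=> cg cd.
pose K (h : R) := segint c d w (fun u' =>
  segint 0 1 (h *: v) g (u' + x *: v)) u.
have cK : continuous K.
  apply: (@continuous_Rintegral_param R^o c d
    (fun h t => segint 0 1 (h *: v) g (u + t *: w + x *: v))).
  apply: (@continuous_Rintegral_param (R^o * R)%type 0 1
    (fun ht s => g (u + ht.2 *: w + x *: v + s *: (ht.1 *: v)))).
  apply: continuous_fun_comp => //.
  have c1 : continuous (fun y : R^o * R * R => y.1.1).
    by move=> y; apply: (@cvg_comp _ _ _ fst fst); exact: cvg_fst.
  have c2 : continuous (fun y : R^o * R * R => y.1.2).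
    by move=> y; apply: (@cvg_comp _ _ _ fst snd);
      [exact: cvg_fst|exact: cvg_snd].
  have c3 : continuous (fun y : R^o * R * R => y.2).
    by move=> y; exact: cvg_snd.
  apply: continuous_funD; last first.
    apply: continuous_funZ; first exact: c3.
    by apply: continuous_funZ; [exact: c1|exact: cst_continuous].
  apply: continuous_funD; last exact: cst_continuous.
  apply: continuous_funD; first exact: cst_continuous.
  by apply: continuous_funZ; [exact: c2|exact: cst_continuous].
have K0 : K 0 = segint c d w g (u + x *: v).
  rewrite /K -segint_shift; congr (segint _ _ _ _ _); apply/funext => u'.
  rewrite /segint scale0r.
  under eq_Rintegral do rewrite scaler0 addr0.
  by rewrite Rintegral_itv_cst// subr0 mulr1.
have KE h : h != 0 -> h^-1 *: (segint c d w (prim v g (h + x)) u -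
    segint c d w (prim v g x) u) = K h.
  move=> h0; rewrite /segint -RintegralB//; last 2 first.
  - apply: continuous_itv_integrable; apply: continuous_line.
    exact: prim_continuous.
  - apply: continuous_itv_integrable; apply: continuous_line.
    exact: prim_continuous.
  under eq_Rintegral do rewrite (addrC h x) primD// /prim.
  rewrite RintegralZl//.
    by rewrite [LHS]mulrA mulVf// mul1r.
  apply: continuous_itv_integrable.
  apply: (@continuous_line _ (fun y => segint 0 1 (h *: v) g (y + x *: v))).
  by apply: continuous_translate; exact: segint_continuous.
have lim : (fun h => h^-1 *: (((fun x =>
  segint c d w (prim v g x) u) \o shift x)
    (h *: 1) - segint c d w (prim v g x) u)) @
      0^' --> segint c d w g (u + x *: v).
  rewrite -K0; have cK0 : K @ 0^' --> K 0 by apply: cvg_within_filter;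
    exact: cK.
  apply: cvg_trans cK0.
  apply: near_eq_cvg; near=> h.
  rewrite -KE; last by near: h; exact: nbhs_dnbhs_neq.
  by rewrite [_ *: 1]mulr1.
apply: DeriveDef; first by apply/cvg_ex; eexists; exact: lim.
by apply/cvg_lim => //; exact: lim.
Unshelve. all: end_near. Qed.

(* Fubini's theorem without product measures: as functions of b, both sides are
   primitives of the same continuous function. *)
Lemma segintC V a b c d (v w : V) (g : V -> R) (u : V) : continuous g ->
    a <= b ->
  c <= d -> segint a b v (segint c d w g) u = segint c d w (segint a b v g) u.
Proof.
move=> cg ab cd; rewrite {1}/segint.
have h (x : R) : x \in `[a, b] -> is_derive x 1 (fun x =>
  segint c d w (prim v g x) u)
    (segint c d w g (u + x *: v)).
  by move=> _; exact: segint_prim_derive.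
have ca := @segint_continuous _ c d w g cg.
have H := Rintegral_FTC2 ab (@continuous_line _ _ u v ca) h.
rewrite [LHS]H /segint -RintegralB//; last 2 first.
- apply: continuous_itv_integrable; apply: continuous_line.
  exact: prim_continuous.
- apply: continuous_itv_integrable; apply: continuous_line.
  exact: prim_continuous.
by apply: eq_Rintegral => t _; rewrite -segint_prim.
Qed.

End SegmentIntegral.

Section SupportsInIntervals.
Variable R : realType.
Local Notation mu := (@lebesgue_measure R).
Implicit Types (F : R -> R) (a b c : R).

Lemma Rintegral_itv_restrict F a b c d : continuous F ->
  (forall t, F t != 0 -> c <= t <= d) ->
  \int[mu]_(t in `[a, b]) F t =
  \int[mu]_(t in `[Num.max a c, Num.min b d]) F t.
Proof.
move=> cF Fcd; rewrite Rintegral_mkcond [RHS]Rintegral_mkcond.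
apply: eq_Rintegral => t _; rewrite !patchE !mem_setE !in_itv/= ge_max le_min.
case: (eqVneq (F t) 0) => [->|/Fcd /andP[-> ->]]; last by rewrite !andbT.
by do 2 case: ifP.
Qed.

Lemma Rintegral_itv_bound_supp F a b c x r : continuous F -> 0 <= r ->
  (forall t, `|F t| <= c) -> (forall t, F t != 0 -> `|t - x| <= r) ->
  `|\int[mu]_(t in `[a, b]) F t| <= c * (2 * r).
Proof.
move=> cF r0 Fc Fx.
have c0 : 0 <= c := le_trans (normr_ge0 _) (Fc 0).
rewrite (@Rintegral_itv_restrict _ _ _ (x - r) (x + r))//; last first.
  by move=> t /Fx; rewrite ler_distl.
have [le|lt] := leP (Num.max a (x - r)) (Num.min b (x + r)); last first.
  by rewrite set_itv_ge -?ltNge// Rintegral_set0 normr0 !mulr_ge0.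
apply: (le_trans (Rintegral_itv_bound (c := c) le cF _)); first by move=> t _.
rewrite ler_wpM2l// lerBlDr.
have : Num.min b (x + r) <= x + r by rewrite ge_min lexx orbT.
have : x - r <= Num.max a (x - r) by rewrite le_max lexx orbT.
lra.
Qed.

Lemma Rintegral_itv_gt0 F a b : continuous F -> (forall t, 0 <= F t) ->
  a < 0 < b -> 0 < F 0 -> 0 < \int[mu]_(t in `[a, b]) F t.
Proof.
move=> cF F0 /andP[a0 b0] F00.
have /cvgrPdist_le/(_ (F 0 / 2)) := cF 0.
move=> /(_ (divr_gt0 F00 (ltr0Sn _ _))) /nbhs_ballP[e /= e0 eF].
(* On [[-d, d]], which lies in [[a, b]], F is at least [F 0 / 2]. Halving [e] puts the closed
   interval inside the open ball. *)
pose d := Num.min (e / 2) (Num.min (- a) b).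
have d0 : 0 < d by rewrite !lt_min divr_gt0// oppr_gt0 a0 b0.
have ad : a <= - d by rewrite lerNr !ge_min lexx !orbT.
have db : d <= b by rewrite !ge_min lexx !orbT.
have de : d < e by rewrite (@le_lt_trans _ _ (e / 2)) ?ge_min ?lexx//; lra.
have dd : - d <= d by lra.
have [P dP] := continuous_has_primitive a b cF.
have FTC x y : a <= x -> x <= y -> y <= b ->
    \int[mu]_(t in `[x, y]) F t = P y - P x.
  move=> ax xy yb.
  have dxy (t : R) : t \in `[x, y] -> is_derive t 1 P (F t).
    rewrite in_itv/= => /andP[xt ty]; apply: dP.
    by rewrite in_itv/= (le_trans ax xt) (le_trans ty yb).
  exact: (Rintegral_FTC2 xy cF dxy).
have ge0 x y : 0 <= \int[mu]_(t in `[x, y]) F t.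
  by apply: Rintegral_ge0 => t _.
have h1 := ge0 a (- d); have h2 := ge0 d b.
have h3 : F 0 / 2 * (d - - d) <= \int[mu]_(t in `[- d, d]) F t.
  rewrite -Rintegral_itv_cst//; apply: le_Rintegral; first by [].
  - apply: (@continuous_itv_integrable _ (fun=> F 0 / 2)).
    exact: cst_continuous.
  - exact: continuous_itv_integrable.
  - move=> t /=; rewrite in_itv/= => td.
    have : `|F 0 - F t| <= F 0 / 2.
      apply: eF; rewrite /ball/= sub0r normrN (le_lt_trans _ de)//.
      by rewrite ler_norml.
    by rewrite ler_norml => /andP[]; lra.
have h4 : 0 < F 0 / 2 * (d - - d) by rewrite mulr_gt0// ?divr_gt0//; lra.
move: h1 h2 h3; rewrite !FTC//; try lra.
Qed.

End SupportsInIntervals.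

Section SegmentIntegralAlgebra.
Variables (R : realType) (V : normedModType R).
Implicit Types (a b c : R) (g : V -> R).

Let ial a b (u v : V) (g : V -> R) (cg : continuous g) :=
  continuous_itv_integrable a b (@continuous_line _ _ g u v cg).

Lemma segintD a b (v : V) g g' : continuous g -> continuous g' ->
  segint a b v (fun x => g x + g' x) = (fun u =>
    segint a b v g u + segint a b v g' u).
Proof.
move=> cg cg'; apply/funext => u; rewrite /segint RintegralD//; exact: ial.
Qed.

Lemma segintZ a b c (v : V) g : continuous g ->
  segint a b v (fun x => c * g x) = (fun u => c * segint a b v g u).
Proof.
move=> cg; apply/funext => u; rewrite /segint RintegralZl//; exact: ial.
Qed.

Lemma le_avg a b (v : V) g g' u : continuous g -> continuous g' ->
  (forall x, g x <= g' x) -> segint a b v g u <= segint a b v g' u.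
Proof.
move=> cg cg' gg'; apply: le_Rintegral => //; try exact: ial.
Qed.

End SegmentIntegralAlgebra.

(** * Iterated integrals over parallelepipeds *)

Section BoxIntegral.
Variable R : realType.
Implicit Types (V : normedModType R) (a b c : R).

(** An entry (a, b, v) integrates over t in [a, b] in the direction v, the head of the list being
    the outermost integral. Bounds are free and V is any normed module, so the same lemmas serve box
    splines, cubes in coordinates, and products of U with spaces of parameters. *)
Definition boxint V (l : seq (R * R * V)) (g : V -> R) : V -> R :=
  foldr (fun x => segint x.1.1 x.1.2 x.2) g l.

Definition ordered_bounds V (l : seq (R * R * V)) :=
  all (fun x => x.1.1 <= x.1.2) l.

Lemma boxint_cat V (l l' : seq (R * R * V)) (g : V -> R) :
  boxint (l ++ l') g = boxint l (boxint l' g).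
Proof. exact: foldr_cat. Qed.

Lemma boxint_continuous V (l : seq (R * R * V)) (g : V -> R) :
  continuous g -> continuous (boxint l g).
Proof. by move=> cg; elim: l => //= x l IH; exact: segint_continuous. Qed.

Lemma boxintD V (l : seq (R * R * V)) (g g' : V -> R) : continuous g ->
    continuous g' ->
  boxint l (fun x => g x + g' x) = (fun u => boxint l g u + boxint l g' u).
Proof.
move=> cg cg'; elim: l => //= x l ->.
by rewrite segintD//; exact: boxint_continuous.
Qed.

Lemma boxintZ V (l : seq (R * R * V)) (c : R) (g : V -> R) : continuous g ->
  boxint l (fun x => c * g x) = (fun u => c * boxint l g u).
Proof.
move=> cg; elim: l => //= x l ->.
by rewrite segintZ//; exact: boxint_continuous.
Qed.

Lemma boxintB V (l : seq (R * R * V)) (g g' : V -> R) : continuous g ->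
    continuous g' ->
  boxint l (fun x => g x - g' x) = (fun u => boxint l g u - boxint l g' u).
Proof.
move=> cg cg'; have cN : continuous (fun x => -1 * g' x).
  by apply: continuous_funM => //; exact: cst_continuous.
under eq_fun do rewrite -[X in _ - X]mul1r -mulNr.
by rewrite boxintD// boxintZ//; under eq_fun do rewrite mulN1r.
Qed.

Lemma boxint0 V (l : seq (R * R * V)) : boxint l (fun=> 0) = (fun=> 0).
Proof.
have := @boxintZ V l 0 (fun=> 0) (@cst_continuous _ _ _).
by rewrite mul0r => ->; under eq_fun do rewrite mul0r.
Qed.

Lemma boxint_sum V (l : seq (R * R * V)) (I : Type) (r : seq I) (f : I ->
    V -> R) :
  (forall i, continuous (f i)) ->
  boxint l (fun x => \sum_(i <- r) f i x) = (fun u =>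
    \sum_(i <- r) boxint l (f i) u).
Proof.
move=> cf; elim: r => [|i r IH].
  by under eq_fun do rewrite big_nil; rewrite boxint0; apply/funext => u;
    rewrite big_nil.
under eq_fun do rewrite big_cons.
rewrite boxintD// ?IH; first by apply/funext => u; rewrite big_cons.
exact: continuous_fun_sum.
Qed.

Lemma le_itg V (l : seq (R * R * V)) (g g' : V -> R) (u : V) : continuous g ->
  continuous g' -> (forall x, g x <= g' x) -> boxint l g u <= boxint l g' u.
Proof.
move=> cg cg' gg'; elim: l u => //= x l IH u.
by apply: le_avg => //; exact: boxint_continuous.
Qed.

Lemma boxint_norm_le V (l : seq (R * R * V)) (g g' : V -> R) (u : V) :
    continuous g ->
  continuous g' -> (forall x, `|g x| <= g' x) ->
    `|boxint l g u| <= boxint l g' u.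
Proof.
move=> cg cg' gg'; rewrite ler_norml -mulN1r; apply/andP; split; last first.
  by apply: le_itg => // x; exact: le_trans (ler_norm _) (gg' x).
have := @boxintZ V l (-1) g' cg'.
move=> /(congr1 (@^~ u)) <-; apply: le_itg => //.
  by apply: continuous_funM => //; exact: cst_continuous.
by move=> x; have := gg' x; rewrite ler_norml mulN1r => /andP[].
Qed.

Lemma boxint_shift V (l : seq (R * R * V)) (g : V -> R) (w u : V) :
  boxint l (fun x => g (x + w)) u = boxint l g (u + w).
Proof.
elim: l u => //= x l IH u; rewrite -segint_shift; congr (segint _ _ _ _ _).
by apply/funext => y; exact: IH.
Qed.

Lemma segint_boxintC V (l : seq (R * R * V)) a b (v : V) (g : V -> R) :
    ordered_bounds l -> a <= b ->
  continuous g -> segint a b v (boxint l g) = boxint l (segint a b v g).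
Proof.
move=> + ab cg; elim: l => //= x l IH /andP[x12 /IH <-].
by apply/funext => u; rewrite segintC//; exact: boxint_continuous.
Qed.

Lemma boxint_boxintC V (l l' : seq (R * R * V)) (g : V -> R) :
    ordered_bounds l -> ordered_bounds l' ->
  continuous g -> boxint l (boxint l' g) = boxint l' (boxint l g).
Proof.
move=> + wl' cg; elim: l => //= x l IH /andP[x12 /IH ->].
by rewrite segint_boxintC//; exact: boxint_continuous.
Qed.

Lemma boxint_perm V (l l' : seq (R * R * V)) (g : V -> R) :
    ordered_bounds l -> perm_eq l l' ->
  continuous g -> boxint l g = boxint l' g.
Proof.
move=> wl pl cg.
suff [_ //] : ordered_bounds l' /\ boxint l g = boxint l' g.
(* Permutations are generated by block exchanges, which are instances of [boxint_boxintC]; the order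
   of the bounds is carried along because each exchange needs it. *)
apply: (@catCA_perm_ind _ (fun k =>
  ordered_bounds k /\ boxint l g = boxint k g) _ _ _ pl
  (conj wl erefl)) => s1 s2 s3 [].
rewrite /ordered_bounds !all_cat => /and3P[w1 w2 w3] ->; rewrite w1 w2 w3;
  split=> //.
by rewrite !boxint_cat boxint_boxintC//; exact: boxint_continuous.
Qed.

(** Change of space along a map that is affine in the directions of [l]. With [phi] the inclusion of
    a slice of a product, it turns an integral depending on parameters into one on the product. *)
Lemma boxint_comp V (W : normedModType R) (l : seq (R * R * V)) (phi : V ->
    W) (f : V -> W) (g : W -> R) (u : V) :
  (forall x t y, x \in l -> phi (y + t *: x.2) = phi y + t *: f x.2) ->
  boxint [seq (x.1, f x.2) | x <- l] g (phi u) = boxint l (g \o phi) u.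
Proof.
elim: l u => //= x l IH u fl.
apply: eq_Rintegral => t _; rewrite -fl ?mem_head// IH// => y s w yl.
by rewrite fl// inE yl orbT.
Qed.

Lemma boxint_const V (l : seq (R * R * V)) (g : V -> R) (c : R) (u : V) :
    ordered_bounds l ->
  (forall x, g x = c) ->
  boxint l g u = c * \prod_(x <- l) (x.1.2 - x.1.1).
Proof.
move=> + gc; elim: l u => [|x l IH] u /=; first by rewrite big_nil mulr1 gc.
move=> /andP[x12 wl]; rewrite big_cons /segint.
under eq_Rintegral do rewrite IH//.
by rewrite Rintegral_itv_cst// -!mulrA (mulrC (\prod_(_ <- _) _)).
Qed.

(** The directions of [l] preserve f, so the integral only evaluates g on the level set of f through
    u. *)
Lemma boxint_eq0 V (l : seq (R * R * V)) (g f : V -> R) (u : V) :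
  (forall x t y, x \in l -> f (y + t *: x.2) = f y) ->
  (forall w, f w = f u -> g w = 0) -> boxint l g u = 0.
Proof.
elim: l u => [|x l IH] u /= fl gf; first exact: gf.
rewrite /segint (_ : (fun t => _) = fun=> 0);
  first by rewrite Rintegral_cst// mul0r.
apply/funext => t; apply: IH => [y s w yl|w]; first by rewrite fl// inE yl orbT.
by rewrite fl ?mem_head//; exact: gf.
Qed.

Lemma boxint_gt0 V (l : seq (R * R * V)) (g : V -> R) (u : V) : continuous g ->
  (forall x, 0 <= g x) -> all (fun x => x.1.1 < 0 < x.1.2) l ->
  0 < g u -> 0 < boxint l g u.
Proof.
move=> cg g0 + gu; elim: l => //= x l IH /andP[x12 /IH il].
apply: Rintegral_itv_gt0 => //.
- by apply: continuous_line; exact: boxint_continuous.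
- move=> t.
  have := @le_itg V l (fun=> 0) g (u + t *: x.2) (@cst_continuous _ _ _) cg g0.
  by rewrite boxint0.
- by rewrite scale0r addr0.
Qed.

(** Substituting c_i + h t for the i-th variable yields one Jacobian factor h per variable and moves
    the base point by the sum of the c_i s_i. *)
Lemma boxint_affine V (I : Type) (r : seq I) (s : I -> V) (c : I ->
    R) (a b h : R)
    (g : V -> R) (u v : V) :
  continuous g -> a <= b -> 0 < h ->
  boxint [seq (c i + h * a, c i + h * b, s i) | i <- r] g (u + h *: v) =
  h ^+ size r * boxint [seq (a, b, s i) | i <- r]
    (fun x => g (u + \sum_(i <- r) c i *: s i + h *: x)) v.
Proof.
move=> cg ab h0; elim: r u v => [|i r IH] u v /=.
  by rewrite big_nil addr0 mul1r.
set l := [seq _ | i <- r]; have cl :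
  continuous (boxint l g) by exact: boxint_continuous.
rewrite segint_affine// exprS -mulrA; congr (_ * _).
rewrite -RintegralZl//; last first.
  apply: continuous_itv_integrable; apply: continuous_line.
  apply: boxint_continuous; apply: continuous_fun_comp => //.
  apply: continuous_funD; first exact: cst_continuous.
  apply: continuous_funZ; [exact: cst_continuous|exact: continuous_fun_id].
apply: eq_Rintegral => t _.
rewrite big_cons (_ : u + h *: v + c i *: s i + t *: (h *: s i) =
  (u + c i *: s i) + h *: (v + t *: s i)).
  by rewrite IH; congr (_ * boxint _ _ _); apply/funext => x; rewrite !addrA.
by rewrite scalerDr !scalerA (mulrC h) -!addrA; congr (_ + _); rewrite addrCA.
Qed.

End BoxIntegral.

(** * Parallelepipeds spanned by a basis *)

Section Coordinates.
Variables (R : realType) (d : nat).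
Local Notation U := 'rV[R]_d.
Implicit Types (b : d.-tuple U) (g : U -> R).

Lemma iterated_integral_itv (x y : R) (vs : seq U) g u :
  iterated_integral `[x, y] vs g u = boxint [seq (x, y, v) | v <- vs] g u.
Proof.
elim: vs u => //= v vs IH u; apply: eq_Rintegral => t _; exact: IH.
Qed.

Lemma coord_continuous_basis b i : continuous (coord b i : U -> R).
Proof.
rewrite (_ : (coord b i : U -> R) =
    fun u : U => \sum_j u 0 j * coord b i (delta_mx 0 j)).
  apply: continuous_fun_sum => j; apply: continuous_funM.
    exact: coord_continuous.
  exact: cst_continuous.
apply/funext => u; rewrite {1}[u]row_sum_delta linear_sum /=.
by apply: eq_bigr => j _; rewrite linearZ.
Qed.

Lemma coord_line b : basis_of fullv b -> forall i j u t,
  coord b i (u + t *: tnth b j) = coord b i u + t * (i == j)%:R.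
Proof.
move=> /basis_free fb i j u t.
by rewrite linearD linearZ/= (tnth_nth 0) coord_free// eq_sym.
Qed.

(** Since u has i-th coordinate 0, the variable t is the i-th coordinate of the point. The later
    directions do not alter it, so for t outside [[x i, y i]] the inner integral vanishes. *)
Lemma iterated_integral_setT_boxint b (r : seq 'I_d) (x y : 'I_d -> R) g u :
  basis_of fullv b -> uniq r ->
  (forall w, g w != 0 -> forall i, i \in r -> x i <= coord b i w <= y i) ->
  (forall i, i \in r -> coord b i u = 0) ->
  iterated_integral setT [seq tnth b i | i <- r] g u =
  boxint [seq (x i, y i, tnth b i) | i <- r] g u.
Proof.
move=> bb; elim: r u => //= i r IH u /andP[ir ur] gb u0.
rewrite /segint [RHS]Rintegral_mkcond; apply: eq_Rintegral => t _.
rewrite IH//; last 2 first.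
- by move=> w gw j jr; apply: gb => //; rewrite inE jr orbT.
- move=> j jr; rewrite coord_line// u0 ?inE ?jr ?orbT// add0r.
  by case: eqVneq jr ir => [->->//|]; rewrite mulr0.
rewrite patchE mem_setE in_itv/=; case: ifPn => // txy.
have lu : coord b i (u + t *: tnth b i) = t.
  by rewrite coord_line// u0 ?mem_head// add0r eqxx mulr1.
apply: (@boxint_eq0 _ _ _ _ (coord b i)).
  move=> _ s w /mapP[j jr ->]; rewrite coord_line//.
  by case: eqVneq ir => [->|_ _]; rewrite ?jr// mulr0 addr0.
move=> w; rewrite lu => wt; apply/eqP; apply: contraNT txy => /gb.
by move=> /(_ i (mem_head _ _)); rewrite wt.
Qed.

(** Each direction contributes a factor 2 rho: the later directions keep the i-th coordinate, so the
    inner integral vanishes unless t is within rho of [c i - coord b i u]. *)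
Lemma boxint_box_bound b (r : seq 'I_d) (c : 'I_d -> R) (C rho : R) g u :
  basis_of fullv b -> uniq r -> continuous g -> 0 <= rho ->
  (forall w, `|g w| <= C) ->
  (forall w, g w != 0 -> forall i, i \in r -> `|coord b i w - c i| <= rho) ->
  `|boxint [seq (0, 1, tnth b i) | i <- r] g u| <= C * (2 * rho) ^+ size r.
Proof.
move=> bb + cg r0 gC; elim: r u => [|i r IH] u /=; first by rewrite mulr1.
move=> /andP[ir ur] gc; rewrite exprSr mulrA.
apply: (@Rintegral_itv_bound_supp _ _ _ _ _ (c i - coord b i u)) => //.
- by apply: continuous_line; exact: boxint_continuous.
- move=> t; apply: IH => // w gw j jr; apply: gc => //.
  by rewrite inE jr orbT.
move=> t; apply: contraNT => tc; apply/eqP.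
have lu : coord b i (u + t *: tnth b i) = coord b i u + t.
  by rewrite coord_line// eqxx mulr1.
apply: (@boxint_eq0 _ _ _ _ (coord b i)).
  move=> _ s w /mapP[j jr ->]; rewrite coord_line//.
  by case: eqVneq ir => [->|_ _]; rewrite ?jr// mulr0 addr0.
move=> w; rewrite lu => wt; apply/eqP; apply: contraNT tc => /gc.
move=> /(_ i (mem_head _ _)); rewrite wt.
by congr (`|_| <= _); ring.
Qed.

End Coordinates.

(** * Boundedness of integrals over spanning lists *)

Lemma exists_basis_sublist (R : realType) (V : vectType R) (Z : seq V) :
  exists b rest, [/\ perm_eq Z (b ++ rest), free b & <<b>>%VS = <<Z>>%VS].
Proof.
elim: Z => [|z Z [b [rest [pZ fb sb]]]].
  by exists [::], [::]; split=> //; rewrite nil_free.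
have [zb|zb] := boolP (z \in <<b>>%VS).
  exists b, (z :: rest); split=> //.
    rewrite perm_sym -cat1s perm_catCA/= perm_cons perm_sym; exact: pZ.
  by rewrite span_cons -sb; apply/esym/addv_idPr.
exists (z :: b), rest; split.
- by rewrite /= perm_cons.
- by rewrite free_cons zb.
- by rewrite !span_cons sb.
Qed.

Section SpanningBound.
Variables (R : realType) (d : nat) (s : d.-tuple 'rV[R]_d).
Hypothesis s_basis : basis_of fullv s.
Local Notation U := 'rV[R]_d.

(* For g at scale rho, i.e. C proportional to rho ^- d, the bound does not
   depend on rho. *)
Lemma boxint_spanning_bound (Z : seq U) : <<Z>>%VS = fullv ->
  exists2 K : R, 0 <= K &
  forall (g : U -> R) (C rho : R) (c u : U), continuous g -> 0 <= rho ->
    (forall w, `|g w| <= C) ->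
    (forall w, g w != 0 -> forall i, `|coord s i (w - c)| <= rho) ->
    `|boxint [seq (0, 1, z) | z <- Z] g u| <= C * (K * rho) ^+ d.
Proof.
move=> Zs; have [b [rest [pZ fb sb]]] := exists_basis_sublist Z.
have sz : size b == d.
  rewrite -[X in _ == X](vector.size_basis s_basis) -Zs -sb.
  by move: fb; rewrite /free eq_sym.
pose bt := Tuple sz.
have bb : basis_of fullv bt by rewrite basisEfree fb/= sb Zs subvv (eqP sz)
  (vector.size_basis s_basis) leqnn.
(* Bounds the passage from [s]-coordinates to [bt]-coordinates. Summing over [j] as well gives one
   constant for all coordinates. *)
pose M := \sum_j \sum_i `|coord bt j (tnth s i)|.
have M0 : 0 <= M by apply: sumr_ge0 => j _; apply: sumr_ge0.
exists (2 * M); first by rewrite mulr_ge0.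
move=> g C rho c u cg rho0 gC gsupp.
have C0 : 0 <= C := le_trans (normr_ge0 _) (gC 0).
have coordM w j : (forall i, `|coord s i w| <= rho) ->
    `|coord bt j w| <= M * rho.
  move=> wr; rewrite (coord_basis s_basis (memvf w)) linear_sum/=.
  apply: (le_trans (ler_norm_sum _ _ _)).
  apply: (@le_trans _ _ ((\sum_i `|coord bt j (tnth s i)|) * rho)).
    rewrite mulr_suml; apply: ler_sum => i _.
    by rewrite linearZ/= normrM mulrC (tnth_nth 0) ler_wpM2l.
  rewrite ler_wpM2r// /M [leRHS](bigD1 j)//= lerDl sumr_ge0// => i _.
  exact: sumr_ge0.
have gcb := @boxint_box_bound R d bt (enum 'I_d) (fun i =>
  coord bt i c) C (M * rho) g.
have gb v : `|boxint [seq (0, 1, z) | z <- b] g v| <= C * (2 * (M * rho)) ^+ d.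
  rewrite -[X in _ ^+ X](size_enum_ord d) (_ :
    b = [seq tnth bt i | i <- enum 'I_d]).
    rewrite -map_comp; apply: gcb => //; first exact: enum_uniq.
      by rewrite mulr_ge0.
    by move=> w gw i _; rewrite -linearB; apply: coordM; exact: gsupp.
  by rewrite -[LHS]/(val bt) -[LHS]map_tnth_enum.
have wfZ : ordered_bounds [seq (0, 1, z) | z <- Z] by apply/allP =>
  _ /mapP[z _ ->] /=.
(* The basis [b] goes innermost and yields the power of rho; the outer intervals have length 1 and
   cost nothing. *)
rewrite (@boxint_perm _ _ _ [seq (0, 1, z) | z <- rest ++ b])//; last first.
  by apply: perm_map; rewrite (perm_trans pZ)// perm_catC.
rewrite map_cat boxint_cat.
apply: (le_trans (@boxint_norm_le _ _ _ _ (fun=> C * (2 * (M * rho)) ^+ d) u _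
  _ gb)).
- exact: boxint_continuous.
- exact: cst_continuous.
rewrite (@boxint_const _ _ _ _ (C * (2 * (M * rho)) ^+ d))//; last first.
  by apply/allP => _ /mapP[z _ ->] /=.
by rewrite big_map big1 ?mulr1 ?mulrA// => z _; rewrite subr0.
Qed.

End SpanningBound.

(** * Smooth functions and constant-coefficient differential operators *)

Section Smooth.
Variables (R : realType) (d : nat).
Local Notation U := 'rV[R]_d.
Implicit Types (phi : U -> R) (Y : seq U).

Definition derives Y phi : U -> R := foldr (fun v f => 'D_v f) phi Y.

Lemma smooth_differentiable phi u : smooth phi -> differentiable phi u.
Proof. by move=> /(_ [::] u). Qed.

Lemma smooth_continuous phi : smooth phi -> continuous phi.
Proof.
by move=> sp u; apply: differentiable_continuous; exact: smooth_differentiable.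
Qed.

Lemma smooth_derives Y phi : smooth phi -> smooth (derives Y phi).
Proof. by move=> sp vs u; rewrite /derives -foldr_cat; exact: sp. Qed.

Lemma smooth_derive v phi : smooth phi -> smooth ('D_v phi).
Proof. exact: (@smooth_derives [:: v]). Qed.

Lemma is_derive_line phi u v (t : R) : smooth phi ->
  is_derive t 1 (fun t => phi (u + t *: v)) ('D_v phi (u + t *: v)).
Proof.
move=> sp.
have dp : derivable phi (u + t *: v) v.
  by apply: diff_derivable; exact: smooth_differentiable.
have E : (fun h : R => h^-1 *: (((fun t =>
  phi (u + t *: v)) \o shift t) (h *: 1)
      - phi (u + t *: v))) =
    (fun h => h^-1 *: ((phi \o shift (u + t *: v)) (h *: v)
      - phi (u + t *: v))).
  by apply/funext => h /=; rewrite [h *: 1]mulr1 scalerDl addrCA.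
by apply: DeriveDef; rewrite /derivable /derive E.
Qed.

Lemma segint_derive a b v phi u : smooth phi -> a <= b ->
  segint a b v ('D_v phi) u = phi (u + b *: v) - phi (u + a *: v).
Proof.
move=> sp ab; have cD := smooth_continuous (smooth_derive v sp).
have dp (t : R) : t \in `[a, b] ->
    is_derive t 1 (fun t => phi (u + t *: v)) ('D_v phi (u + t *: v)).
  by move=> _; exact: is_derive_line.
exact: (Rintegral_FTC2 ab (@continuous_line _ _ _ u v cD) dp).
Qed.

(** By continuity g u is the limit of the averages of g over the segments from u to u + t v as t
    decreases to 0, and these averages vanish. *)
Lemma segint_eq0_fun0 (g : U -> R) v : continuous g ->
  (forall u t, 0 < t -> segint 0 t v g u = 0) -> forall u, g u = 0.
Proof.
move=> cg g0 u; apply/eqP; rewrite -normr_le0; apply/ler_addgt0Pr => e e0.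
have cl := @continuous_line _ _ g u v cg.
have /cvgrPdist_le/(_ _ e0)/nbhs_ballP[r /= r0 rg] := cl 0.
have r2 : 0 < r / 2 by rewrite divr_gt0.
have := g0 u _ r2; rewrite /segint => I0.
have := @Rintegral_itv_bound R (fun t => g u - g (u + t *: v)) 0 (r / 2) e
  (ltW r2).
have cc : continuous (fun t : R => g u - g (u + t *: v)).
  by apply: continuous_funB => //; exact: cst_continuous.
move=> /(_ cc).
rewrite RintegralB//; last 2 first.
- by apply: (continuous_itv_integrable _ _ (@cst_continuous _ _ (g u))).
- exact: (continuous_itv_integrable _ _ cl).
rewrite I0 Rintegral_itv_cst; last exact: ltW.
rewrite !subr0 normrM [`|r / 2|]gtr0_norm//.
rewrite ler_pM2r// add0r; apply => t; rewrite in_itv/= => /andP[t0 tr].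
have := rg t; rewrite /= scale0r addr0; apply.
by rewrite /ball/= sub0r normrN ger0_norm// (le_lt_trans tr)//; lra.
Qed.

Lemma segint2_inj v w (f g : U -> R) : continuous f -> continuous g ->
  (forall u t r, 0 < t -> 0 < r ->
    segint 0 t v (segint 0 r w f) u = segint 0 t v (segint 0 r w g) u) -> f = g.
Proof.
move=> cf cg fg.
have cn : continuous (fun x => -1 * g x).
  by apply: continuous_funM => //; exact: cst_continuous.
have ck : continuous (fun x => f x + -1 * g x) by exact: continuous_funD.
apply/funext => u; apply/eqP; rewrite -subr_eq0 -mulN1r; apply/eqP.
apply: (@segint_eq0_fun0 _ w ck) => {}u r r0.
apply: (@segint_eq0_fun0 _ v (segint_continuous ck)) => {}u t t0.
rewrite segintD// segintZ// segintD; [|exact: segint_continuous|]; last first.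
  apply: continuous_funM; [exact: cst_continuous|exact: segint_continuous].
by rewrite segintZ ?fg// ?mulN1r ?subrr//; exact: segint_continuous.
Qed.

(* Both sides have the same integral over every parallelogram spanned by
   positive multiples of v and w, namely a second difference of phi. *)
Lemma derive_comm v w phi : smooth phi -> 'D_v ('D_w phi) = 'D_w ('D_v phi).
Proof.
move=> sp.
have cD v1 v2 : continuous ('D_v1 ('D_v2 phi)).
  by apply: smooth_continuous; do 2 apply: smooth_derive.
have h v1 v2 (t r : R) u : 0 < t -> 0 < r ->
    segint 0 t v1 (segint 0 r v2 ('D_v1 ('D_v2 phi))) u =
    phi (u + t *: v1 + r *: v2) - phi (u + t *: v1) -
      (phi (u + r *: v2) - phi u).
  move=> t0 r0; rewrite segintC ?ltW//.
  rewrite (_ : segint 0 t v1 _ = fun x =>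
    'D_v2 phi (x + t *: v1) - 'D_v2 phi x).
    have cd : continuous ('D_v2 phi).
      by apply: smooth_continuous; exact: smooth_derive.
    have cs : continuous (fun x => 'D_v2 phi (x + t *: v1)).
      exact: (@continuous_translate _ _ ('D_v2 phi) (t *: v1) cd).
    rewrite /segint RintegralB; [|by []| |].
    - rewrite -/(segint 0 r v2 (fun x => 'D_v2 phi (x + t *: v1)) u).
      rewrite -/(segint 0 r v2 ('D_v2 phi) u) (segint_shift _ _ _ _ _ ('D_v2
        phi)).
      rewrite !segint_derive ?ltW//.
      by rewrite scale0r !addr0.
    - exact: (continuous_itv_integrable 0 r
        (@continuous_line _ _ (fun x => 'D_v2 phi (x + t *: v1)) u v2 cs)).
    - exact: (continuous_itv_integrable 0 r
        (@continuous_line _ _ ('D_v2 phi) u v2 cd)).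
  apply/funext => x; rewrite segint_derive ?ltW//; last exact: smooth_derive.
  by rewrite scale0r addr0.
apply: (@segint2_inj v w _ _ (cD v w) (cD w v)) => u t r t0 r0.
apply: etrans (h v w t r u t0 r0) _.
apply/esym; apply: etrans (segintC v w u (cD w v) (ltW t0) (ltW r0)) _.
apply: etrans (h w v r t u r0 t0) _.
by rewrite [u + t *: v + r *: w]addrAC; ring.
Qed.

Lemma derives_comm v Y phi : smooth phi ->
  derives Y ('D_v phi) = 'D_v (derives Y phi).
Proof.
move=> sp; elim: Y => //= w Y ->.
exact: (derive_comm w v (smooth_derives Y sp)).
Qed.

End Smooth.

(** * The action of p(D) on distributions *)

Section DiffOp.
Variables (R : realType) (d : nat).
Local Notation U := 'rV[R]_d.
Implicit Types (phi : U -> R) (Y : seq U).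

Lemma derives_sum (I : Type) (r : seq I) (c : I -> R) (f : I -> U -> R) Y :
  (forall i, smooth (f i)) ->
  derives Y (fun x => \sum_(i <- r) c i * f i x) =
  fun x => \sum_(i <- r) c i * derives Y (f i) x.
Proof.
move=> sf; elim: Y => //= v Y ->; apply/funext => u.
have sg i : smooth (derives Y (f i)) by exact: smooth_derives.
have H : is_derive u v (fun x => \sum_(i <- r) c i * derives Y (f i) x)
    (\sum_(i <- r) c i * 'D_v (derives Y (f i)) u).
  elim: r => [|i r IH].
    rewrite big_nil (_ : (fun x => _) = cst 0); first exact: is_derive_cst.
    by apply/funext => x; rewrite big_nil.
  rewrite big_cons (_ : (fun x => _) = (c i *: derives Y (f i)) +
      (fun x => \sum_(i <- r) c i * derives Y (f i) x)).
    have dfi : is_derive u v (derives Y (f i)) ('D_v (derives Y (f i)) u).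
      apply/derivableP/diff_derivable; exact: smooth_differentiable.
    exact: (is_deriveD (is_deriveZ (c i) dfi) IH).
  by apply/funext => x; rewrite big_cons.
by have [_ ->] := H.
Qed.

Lemma derive_linear_comb (I : Type) (r : seq I) (c : I -> R) (v : I -> U) phi :
  smooth phi ->
  'D_(\sum_(i <- r) c i *: v i) phi = fun x =>
    \sum_(i <- r) c i * 'D_(v i) phi x.
Proof.
move=> sp; apply/funext => u.
have dp := smooth_differentiable u sp.
rewrite deriveE// linear_sum; apply: eq_bigr => i _.
by rewrite linearZ -deriveE.
Qed.

Lemma iter_distr_derive k v (S : functional R d) phi :
  iter k (distr_derive v) S phi = (-1) ^+ k * S (derives (nseq k v) phi).
Proof.
elim: k phi => [|k IH] phi; first by rewrite mul1r.
rewrite iterS /distr_derive IH exprS mulN1r mulNr; congr (- (_ * S _)).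
by rewrite -[k.+1]addn1 nseqD /derives foldr_cat.
Qed.

Variables (s : d.-tuple U) (T : functional R d).

(** The inner fold of [distr_diffop], over an arbitrary list of variables in place of [enum 'I_d] to
    allow induction. *)
Definition distr_monomial (r : seq 'I_d) (m : multinom d) : functional R d :=
  foldr (fun i S => iter (m i) (distr_derive (tnth s i)) S) T r.

Lemma distr_diffopE p phi : distr_diffop s p T phi =
  \sum_(m <- msupp p) mcoeff m p * distr_monomial (enum 'I_d) m phi.
Proof. by []. Qed.

Lemma distr_monomial_cons i r m phi : distr_monomial (i :: r) m phi =
  (-1) ^+ m i * distr_monomial r m (derives (nseq (m i) (tnth s i)) phi).
Proof. exact: iter_distr_derive. Qed.

(** The extra derivative along s_i can be moved past the others because derivatives of smooth
    functions commute; [uniq r] ensures that the variable i is met at most once. *)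
Lemma distr_monomialD1 i r m phi : smooth phi -> uniq r ->
  distr_monomial r (mnm_add (mnm1 i) m) phi =
  if i \in r then - distr_monomial r m ('D_(tnth s i) phi)
  else distr_monomial r m phi.
Proof.
elim: r phi => [|j r IH] phi sp; first by [].
rewrite cons_uniq => /andP[jr ur].
rewrite !distr_monomial_cons IH//; last exact: smooth_derives.
rewrite mnmDE mnm1E inE; have [ij|ij] := eqVneq i j.
  rewrite ij (negPf jr) exprS mulN1r mulNr.
  by rewrite [(true + _)%N]addnC nseqD /derives foldr_cat.
case: ifP => // ir; rewrite derives_comm//.
by rewrite mulrN.
Qed.

(** Allows several polynomials to be summed over one common list of monomials, although supports can
    shrink by cancellation in a linear combination. *)
Lemma mcoeff_sum_supset (p : mpoly d R) (r : seq (multinom d))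
    (E : multinom d -> R) : uniq r -> {subset msupp p <= r} ->
  \sum_(m <- msupp p) mcoeff m p * E m = \sum_(m <- r) mcoeff m p * E m.
Proof.
move=> ur pr; rewrite [RHS](bigID (fun m => m \in msupp p))/=.
rewrite [X in _ + X]big1 ?addr0; last first.
  by move=> m; rewrite mcoeff_msupp negbK => /eqP ->; rewrite mul0r.
rewrite -[RHS]big_filter; apply: perm_big; apply: uniq_perm.
- exact: msupp_uniq.
- exact: filter_uniq.
- move=> m; rewrite mem_filter andb_idr//; exact: pr.
Qed.

Lemma distr_diffop_lin (n : nat) (c : 'I_n -> R) (q : 'I_n -> mpoly d R) phi :
  distr_diffop s (\sum_(i < n) c i *: q i) T phi =
  \sum_(i < n) c i * distr_diffop s (q i) T phi.
Proof.
pose p := \sum_(i < n) c i *: q i.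
pose r := undup (msupp p ++ flatten [seq msupp (q i) | i <- enum 'I_n]).
have ur : uniq r by exact: undup_uniq.
rewrite distr_diffopE (mcoeff_sum_supset _ ur); last first.
  by move=> m mp; rewrite mem_undup mem_cat mp.
transitivity (\sum_(i < n) \sum_(m <- r) c i * (mcoeff m (q i) *
    distr_monomial (enum 'I_d) m phi)); last first.
  apply: eq_bigr => i _; rewrite -mulr_sumr distr_diffopE.
  rewrite (mcoeff_sum_supset _ ur)// => m mq.
  rewrite mem_undup mem_cat; apply/orP; right; apply/flattenP.
  by exists (msupp (q i)) => //; apply: map_f; rewrite mem_enum.
rewrite exchange_big; apply: eq_bigr => m _.
rewrite (raddf_sum (mcoeff m)) mulr_suml; apply: eq_bigr => i _.
by rewrite /= mcoeffZ mulrA.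
Qed.

Lemma distr_diffopMX (q : mpoly d R) i phi : smooth phi ->
  distr_diffop s (q * mpolyX R (mnm1 i)) T phi =
  - distr_diffop s q T ('D_(tnth s i) phi).
Proof.
move=> sp; rewrite !distr_diffopE (perm_big _ (msuppMX q (mnm1 i))) big_map.
rewrite -sumrN; apply: eq_bigr => m _.
by rewrite mcoeffMX distr_monomialD1 ?enum_uniq// mem_enum mulrN.
Qed.

Hypothesis T_lin : forall (n : nat) (c : 'I_n -> R) (f : 'I_n -> U -> R),
  (forall i, smooth (f i)) ->
  T (fun x => \sum_i c i * f i x) = \sum_i c i * T (f i).

Lemma distr_monomial_lin r m n (c : 'I_n -> R) (f : 'I_n -> U -> R) :
  (forall i, smooth (f i)) ->
  distr_monomial r m (fun x => \sum_i c i * f i x) =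
  \sum_i c i * distr_monomial r m (f i).
Proof.
elim: r f => [|j r IH] f sf; first exact: T_lin.
rewrite distr_monomial_cons derives_sum// IH; last first.
  by move=> i; exact: smooth_derives.
rewrite mulr_sumr; apply: eq_bigr => i _.
by rewrite distr_monomial_cons mulrCA.
Qed.

Hypothesis s_basis : basis_of fullv s.

(** Multiplication by the variable s_i produces a derivative along s_i; linearity of T gathers
    these, with the coordinates of v as weights, into the derivative along v. *)
Lemma distr_diffopM_sym_vec (q : mpoly d R) v phi : smooth phi ->
  distr_diffop s (sym_vec s v * q) T phi = - distr_diffop s q T ('D_v phi).
Proof.
move=> sp; rewrite mulrC /sym_vec mulr_sumr.
under eq_bigr do rewrite -scalerAr.
rewrite distr_diffop_lin.
under eq_bigr do rewrite distr_diffopMX// mulrN.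
rewrite sumrN; congr (- _).
have vE : \sum_i coord s i v *: tnth s i = v.
  rewrite [RHS](coord_basis s_basis (memvf v)); apply: eq_bigr => i _.
  by rewrite (tnth_nth 0).
have := derive_linear_comb (index_enum _) (fun i => coord s i v) (tnth s) sp.
rewrite vE => ->.
have sf i : smooth ('D_(tnth s i) phi) by exact: smooth_derive.
rewrite [RHS]distr_diffopE.
under [RHS]eq_bigr => m _ do rewrite (distr_monomial_lin _ _ _ sf).
under [LHS]eq_bigr do rewrite distr_diffopE mulr_sumr.
rewrite exchange_big; apply: eq_bigr => m _.
by rewrite mulr_sumr; apply: eq_bigr => i _; rewrite mulrCA.
Qed.

Lemma distr_diffop_sym_list Y phi : smooth phi ->
  distr_diffop s (sym_list s Y) T phi = (-1) ^+ size Y * T (derives Y phi).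
Proof.
elim: Y phi => [|y Y IH] phi sp.
  rewrite /sym_list big_nil mul1r distr_diffopE msupp1 big_seq1 mcoeff1 eqxx.
  rewrite mul1r; elim: (enum _) => // i r.
  by rewrite distr_monomial_cons mnm0E mul1r.
rewrite /sym_list big_cons distr_diffopM_sym_vec// IH;
  last exact: smooth_derive.
by rewrite derives_comm// exprS mulN1r mulNr.
Qed.

End DiffOp.

(** * Derivatives of box splines *)

Section BoxSpline.
Variables (R : realType) (d : nat).
Local Notation U := 'rV[R]_d.
Implicit Types (phi : U -> R) (X Y Z W : seq U) (D : seq (R * seq U * U)).

Definition unit_segs Z : seq (R * R * U) := [seq (0, 1, z) | z <- Z].

Lemma unit_segs_ordered Z : ordered_bounds (unit_segs Z).
Proof. by apply/allP => _ /mapP[z _ ->] /=. Qed.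

(* A triple (c, Z, w) stands for c times the box spline B_Z translated by w. *)
Definition box_comb D phi : R :=
  \sum_(q <- D) q.1.1 * boxint (unit_segs q.1.2) phi q.2.

Lemma box_splineE X phi : box_spline X phi = boxint (unit_segs X) phi 0.
Proof. exact: iterated_integral_itv. Qed.

Lemma boxint_unit_segs_derives Y : exists E :
    seq (R * U), forall phi, smooth phi ->
  boxint (unit_segs Y) (derives Y phi) =
  fun u => \sum_(e <- E) e.1 * phi (u + e.2).
Proof.
elim: Y => [|y Y [E IH]].
  exists [:: (1, 0)] => phi _; apply/funext => u.
  by rewrite big_seq1 mul1r addr0.
(* The difference operator of step [y] replaces each translate by its shift by [y] minus itself. The
   list depends on [Y] only, not on [phi]. *)
exists ([seq (e.1, y + e.2) | e <- E] ++ [seq (- e.1, e.2) | e <- E]).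
move=> phi sp; have sY := smooth_derives Y sp.
have cY := smooth_continuous sY.
(* The segment of [y] goes innermost, next to the derivative along [y]. *)
rewrite (@boxint_perm _ _ _ (unit_segs (Y ++ [:: y]))); last 3 first.
- exact: unit_segs_ordered.
- by apply: perm_map; rewrite perm_sym cats1 perm_rcons.
- exact: (smooth_continuous (smooth_derive y sY)).
rewrite /unit_segs map_cat boxint_cat -/(unit_segs Y) /=.
rewrite (_ : segint 0 1 y _ = fun u => derives Y phi (u + y) - derives Y phi u).
  rewrite boxintB//; last first.
    exact: continuous_translate.
  apply/funext => u; rewrite boxint_shift (IH _ sp) big_cat !big_map/= -sumrN.
  by congr (_ + _); apply: eq_bigr => e _; rewrite ?addrA ?mulNr.
apply/funext => u; rewrite (segint_derive y u sY ler01).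
by rewrite scale1r scale0r addr0.
Qed.

Lemma perm_mask_negb (T : eqType) (m : bitseq) (W : seq T) :
  size m = size W -> perm_eq W (mask (map negb m) W ++ mask m W).
Proof.
elim: W m => [|w W IH] [|b m] //= [] /IH pW.
case: b => /=; last by rewrite perm_cons.
by rewrite perm_sym -cat1s perm_catCA/= perm_cons perm_sym.
Qed.

Lemma linear_box_spline X n (c : 'I_n -> R) (f : 'I_n -> U -> R) :
  (forall i, smooth (f i)) ->
  box_spline X (fun x => \sum_i c i * f i x) = \sum_i c i * box_spline X (f i).
Proof.
move=> sf; rewrite box_splineE boxint_sum; last first.
  move=> i; apply: continuous_funM; first exact: cst_continuous.
  exact: smooth_continuous.
apply: eq_bigr => i _; rewrite boxintZ ?box_splineE//; exact: smooth_continuous.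
Qed.

Variable s : d.-tuple U.
Hypothesis s_basis : basis_of fullv s.

(* Write p as a combination of p_Y with Y a sublist of X \ x whose complement Z
   spans. Integrating D_y over the segment [0, y] gives the difference operator
   of step y, so p_Y(D) B_X is a combination of translates of B_(x :: Z). *)
Lemma distr_diffop_box_comb X (p : mpoly d R) x : internal_space s X p ->
  x \in X -> exists D,
    (forall q, q \in D -> exists2 Z, q.1.2 = x :: Z & <<Z>>%VS = fullv) /\
    (forall phi, smooth phi ->
      distr_diffop s p (box_spline X) phi = box_comb D phi).
Proof.
move=> ip xX; have [n [c [g [gm ->]]]] := ip x xX.
have /choice[D HD] : forall i, exists D,
    (forall q, q \in D -> exists2 Z, q.1.2 = x :: Z & <<Z>>%VS = fullv) /\
    (forall phi, smooth phi ->
      distr_diffop s (g i) (box_spline X) phi = box_comb D phi).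
  move=> i; have [m [sm dm] <-] := gm i.
  set W := rem x X; set Y := mask m W; set Z := mask (map negb m) W.
  have [E HE] := boxint_unit_segs_derives Y.
  (* The sign comes from moving [size Y] derivatives onto the test function. *)
  exists [seq ((-1) ^+ size Y * e.1, x :: Z, e.2) | e <- E]; split.
    move=> _ /mapP[e _ ->] /=; exists Z => //.
    by apply/eqP; rewrite eqEdim subvf/= dm.
  move=> phi sp; rewrite (distr_diffop_sym_list (linear_box_spline X)
    s_basis)//.
  (* The segments of [Y] go innermost, where they absorb the derivatives along [Y]; those of
     [x :: Z] remain. *)
  rewrite box_splineE (@boxint_perm _ _ _ (unit_segs ((x :: Z) ++ Y)));
    last 3 first.
  - exact: unit_segs_ordered.
  - apply: perm_map; rewrite (perm_trans (perm_to_rem xX))//= perm_cons.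
    exact: perm_mask_negb.
  - by apply: smooth_continuous; exact: smooth_derives.
  rewrite /unit_segs map_cat boxint_cat -!/(unit_segs _) HE//.
  have cs (e : R * U) : continuous (fun u : U => phi (u + e.2)).
    exact: continuous_translate (smooth_continuous sp).
  rewrite boxint_sum; last first.
    by move=> e; apply: continuous_funM => //; exact: cst_continuous.
  rewrite mulr_sumr /box_comb big_map; apply: eq_bigr => e _.
  by rewrite boxintZ// boxint_shift add0r mulrA.
exists (flatten [seq [seq (c i * q.1.1, q.1.2,
  q.2) | q <- D i] | i <- enum 'I_n]).
split.
  move=> q /flattenP[_ /mapP[i _ ->] /mapP[r rD ->]] /=.
  by have [H _] := HD i; exact: H.
move=> phi sp; rewrite distr_diffop_lin /box_comb big_flatten big_map big_enum.
apply: eq_bigr => i _; have [_ ->//] := HD i.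
by rewrite /box_comb big_map mulr_sumr; apply: eq_bigr => q _; rewrite mulrA.
Qed.

End BoxSpline.

(** * A smooth mollifier *)

Section Flat.
Variable R : realType.
Implicit Types (n : nat) (x y : R).

(* All derivatives of flat 0 = exp (- 1 / x) are combinations of these. *)
Definition flat n x : R := if 0 < x then x^-1 ^+ n * expR (- x^-1) else 0.

Lemma flat_ge0 n x : 0 <= flat n x.
Proof.
rewrite /flat; case: ifP => // x0.
by rewrite mulr_ge0 ?expR_ge0// exprn_ge0// invr_ge0 ltW.
Qed.

Lemma flat0_gt0 x : 0 < x -> 0 < flat 0 x.
Proof. by move=> x0; rewrite /flat x0 mul1r expR_gt0. Qed.

Lemma flat_eq0 n x : x <= 0 -> flat n x = 0.
Proof. by move=> x0; rewrite /flat ltNge x0. Qed.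

(** With y = 1 / x, the term y^(n+2) / (n+2)! of the exponential series is at most exp y. The
    exponent is chosen to leave x^2, which makes [flat n] differentiable at 0 with derivative 0. *)
Lemma flat_le n x : `|flat n x| <= n.+2`!%:R * x ^+ 2.
Proof.
rewrite ger0_norm ?flat_ge0// /flat; case: ifPn => [x0|_]; last first.
  by rewrite mulr_ge0// sqr_ge0.
rewrite expRN ler_pdivrMr ?expR_gt0//.
have y0 : 0 <= x^-1 by rewrite invr_ge0 ltW.
have := expR_ge1Dxn n.+1 y0; set e := expR _ => He.
have f0 : 0 < n.+2`!%:R :> R by rewrite ltr0n fact_gt0.
have : x^-1 ^+ n.+2 <= n.+2`!%:R * e.
  by rewrite mulrC -ler_pdivrMr// (le_trans _ He)// lerDr.
move=> H; have x20 : 0 < x ^+ 2 by rewrite exprn_gt0.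
apply: (@le_trans _ _ (x^-1 ^+ n.+2 * x ^+ 2)).
  rewrite -[n.+2]addn2 exprD -mulrA -exprMn mulVf ?gt_eqF// expr1n mulr1//.
by rewrite [leRHS]mulrAC ler_pM2r.
Qed.

Lemma is_derive_flat n x :
  is_derive x 1 (flat n) (flat n.+2 x - n%:R * flat n.+1 x).
Proof.
have [x0|x0|->] := ltgtP x 0.
- rewrite !flat_eq0 ?ltW// mulr0 subr0.
  apply: (near_eq_is_derive _ (is_derive_cst (0 : R) x 1)).
  near=> y; rewrite flat_eq0// ltW//; near: y; exact: lt_nbhsl.
- pose h y : R := y ^+ n * expR (- y).
  have dh y : is_derive y 1 h
      (y ^+ n * - expR (- y) + expR (- y) * (n%:R * y ^+ n.-1)).
    have d1 : is_derive y 1 (fun y : R => y ^+ n) (n%:R * y ^+ n.-1).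
      apply: DeriveDef; first exact: exprn_derivable.
      by rewrite exp_derive [_ *: 1]mulr1.
    have d2 : is_derive y 1 (fun y : R => expR (- y)) (- expR (- y)).
      have := @is_derive1_comp _ expR -%R y _ _ (is_derive_expR _)
        (is_deriveNid y 1).
      by rewrite mulrN1.
    exact: (is_deriveM d1 d2).
  have xN0 : x != 0 by rewrite gt_eqF.
  have di : is_derive x 1 (fun y : R => y^-1) (- x ^- 2).
    have did : derivable (id : R -> R) x 1 by exact: derivable_id.
    have H := @derivableV _ _ id x 1 xN0 did.
    apply: DeriveDef; first exact: H.
    have := @deriveV _ _ id x 1 xN0 did.
    by rewrite derive_id [_ *: 1]mulr1.
  have -> : flat n.+2 x - n%:R * flat n.+1 x =
     (x^-1 ^+ n * - expR (- x^-1) + expR (- x^-1) * (n%:R * x^-1 ^+ n.-1)) *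
     (- x ^- 2).
    (* For [n = 0] the truncated exponent [n.-1] is harmless, its factor [n%:R] being 0. *)
    rewrite /flat x0; case: n {h dh} => [|n] /=;
      rewrite -?exprVn !exprS expr0; ring.
  apply: (near_eq_is_derive _ (is_derive1_comp (dh x^-1) di)).
  near=> y; rewrite /flat ifT//; near: y; exact: lt_nbhsr.
- rewrite !flat_eq0// mulr0 subr0.
  (* By [flat_le] the difference quotient at 0 is at most a constant times [|h|]. *)
  have lim : (fun h => h^-1 *: ((flat n \o shift 0) (h *: 1) - flat n 0))
      @ 0^' --> (0 : R).
    apply/cvgr0Pnorm_le => e e0.
    have C0 : 0 < n.+2`!%:R :> R by rewrite ltr0n fact_gt0.
    near=> h; rewrite /= addr0 [h *: 1]mulr1 (flat_eq0 _ (lexx 0)) subr0.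
    have h0 : h != 0 by near: h; exact: nbhs_dnbhs_neq.
    rewrite normrM normfV ler_pdivrMl ?normr_gt0//.
    apply: le_trans (flat_le n h) _.
    rewrite -(real_normK (num_real h)) expr2 mulrCA ler_pM2l ?normr_gt0//.
    rewrite mulrC -ler_pdivlMr//; near: h.
    by apply: dnbhs0_le; rewrite divr_gt0.
  apply: DeriveDef; first by apply/cvg_ex; eexists; exact: lim.
  by apply/cvg_lim => //; exact: lim.
Unshelve. all: end_near. Qed.

End Flat.

Section Bump.
Variables (R : realType) (d : nat) (s : d.-tuple 'rV[R]_d).
Local Notation U := 'rV[R]_d.
Implicit Types (u v w : U) (f g : U -> R).

(** A class of differentiable functions closed under every directional derivative. Smoothness, which
    concerns all iterated derivatives, thereby reduces to one derivative at a time. *)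
Inductive flat_algebra : (U -> R) -> Prop :=
| flat_cst c : flat_algebra (fun=> c)
| flat_add f g : flat_algebra f -> flat_algebra g ->
    flat_algebra (fun x => f x + g x)
| flat_mul f g : flat_algebra f -> flat_algebra g ->
    flat_algebra (fun x => f x * g x)
| flat_coord n a k i : flat_algebra (fun x => flat n (a + k * coord s i x)).

Lemma is_derive_of_line f u v l :
  is_derive (0 : R) 1 (fun t => f (u + t *: v)) l -> is_derive u v f l.
Proof.
move=> [df lf].
have E : (fun h : R => h^-1 *: (((fun t => f (u + t *: v)) \o shift 0) (h *: 1)
      - f (u + 0 *: v))) =
    (fun h => h^-1 *: ((f \o shift u) (h *: v) - f u)).
  apply/funext => h /=.
  by rewrite [h *: 1]mulr1 addr0 scale0r addr0 (addrC u).
by move: df lf; rewrite /derivable /derive E => df lf; apply: DeriveDef.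
Qed.

Lemma flat_algebra_derive f v : flat_algebra f ->
  exists2 g, flat_algebra g & forall u, is_derive u v f (g u).
Proof.
elim=> [c|{}f g _ [f' af' df] _ [g' ag' dg]|{}f g af [f' af' df] ag [g' ag'
  dg]|n a k i].
- exists (fun=> 0); first exact: flat_cst.
  by move=> u; exact: is_derive_cst.
- exists (fun x => f' x + g' x); first exact: flat_add.
  by move=> u; exact: is_deriveD.
- exists (fun x => f x * g' x + g x * f' x).
    by apply: flat_add; apply: flat_mul.
  by move=> u; exact: is_deriveM.
exists (fun x => (k * coord s i v) * (flat n.+2 (a + k * coord s i x) +
   - n%:R * flat n.+1 (a + k * coord s i x))).
  apply: flat_mul; first exact: flat_cst.
  apply: flat_add; first exact: flat_coord.
  by apply: flat_mul; [exact: flat_cst|exact: flat_coord].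
move=> u; apply: is_derive_of_line.
have := @is_derive_affine R (flat n) (a + k * coord s i u) (k * coord s i v) 0 _
  (is_derive_flat _ _).
rewrite mulr0 addr0 mulNr; congr (is_derive _ _ _ _); apply/funext => t.
by rewrite linearD linearZ/=; congr (flat _ _); ring.
Qed.

Lemma flat_algebra_differentiable f u : flat_algebra f -> differentiable f u.
Proof.
elim=> [c|{}f g _ df _ dg|{}f g _ df _ dg|n a k i].
- exact: differentiable_cst.
- exact: differentiableD.
- exact: differentiableM.
apply: (@differentiable_comp _ _ _ _ (fun x => a + k * coord s i x) (flat n)).
  apply: differentiableD; first exact: differentiable_cst.
  apply: differentiableZ; apply: linear_differentiable.
  exact: coord_continuous_basis.
by apply/derivable1_diffP; have [] := is_derive_flat n (a + k * coord s i u).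
Qed.

Lemma flat_algebra_smooth f : flat_algebra f -> smooth f.
Proof.
move=> af vs u; apply: flat_algebra_differentiable.
elim: vs => //= v vs /(@flat_algebra_derive _ v)[g ag dg].
rewrite (_ : 'D_v _ = g)//; apply/funext => w.
by have [_ ->] := dg w.
Qed.

(** Positive exactly where all coordinates in [s] lie strictly between -1 and 1. *)
Definition bump_fun u : R := \prod_(i < d)
  (flat 0 (1 + coord s i u) * flat 0 (1 - coord s i u)).

Lemma smooth_bump_fun (c k : R) w : smooth (fun u =>
    c * bump_fun (k *: (u - w))).
Proof.
apply: flat_algebra_smooth; apply: flat_mul; first exact: flat_cst.
rewrite /bump_fun; elim: (index_enum _) => [|i r IH].
  under eq_fun do rewrite big_nil; exact: flat_cst.
under eq_fun do rewrite big_cons; apply: flat_mul => //; apply: flat_mul.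
- rewrite (_ : (fun u => _) = (fun u => flat 0 ((1 - k * coord s i w) +
    k * coord s i u))); first exact: flat_coord.
  apply/funext => u; rewrite linearZ linearB /=; congr (flat _ _); ring.
- rewrite (_ : (fun u => _) = (fun u => flat 0 ((1 + k * coord s i w) +
    (- k) * coord s i u))); first exact: flat_coord.
  apply/funext => u; rewrite linearZ linearB /=; congr (flat _ _); ring.
Qed.

Lemma bump_fun_ge0 u : 0 <= bump_fun u.
Proof. by apply: prodr_ge0 => i _; rewrite mulr_ge0// flat_ge0. Qed.

Lemma bump_fun_le1 u : bump_fun u <= 1.
Proof.
have f1 x : flat 0 x <= 1 :> R.
  rewrite /flat; case: ifP => // x0; rewrite mul1r expR_le1 oppr_le0.
  by rewrite invr_ge0 ltW.
suff /andP[] : 0 <= bump_fun u <= 1 by [].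
rewrite /bump_fun; elim/big_ind : _ => [|x y /andP[x0 x1] /andP[y0 y1]|i _].
- by rewrite ler01 lexx.
- by rewrite mulr_ge0//= mulr_ile1.
- by rewrite mulr_ge0 ?flat_ge0//= mulr_ile1 ?flat_ge0.
Qed.

Lemma bump_fun_supp u : bump_fun u != 0 -> forall i, `|coord s i u| <= 1.
Proof.
move=> /prodf_neq0 bu i; have := bu i isT; rewrite mulf_eq0 negb_or.
move=> /andP[h1 h2]; rewrite ler_norml.
have : 0 < 1 + coord s i u by rewrite ltNge; apply: contraNN h1 => /flat_eq0 ->.
have : 0 < 1 - coord s i u by rewrite ltNge; apply: contraNN h2 => /flat_eq0 ->.
by move=> *; apply/andP; split; lra.
Qed.

Lemma bump_funN u : bump_fun (- u) = bump_fun u.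
Proof.
by apply: eq_bigr => i _; rewrite linearN/= opprK mulrC.
Qed.

Lemma bump_fun0_gt0 : 0 < bump_fun 0.
Proof.
apply: prodr_gt0 => i _; rewrite linear0 addr0 subr0.
by rewrite mulr_gt0 ?flat0_gt0.
Qed.

Lemma bump_fun_continuous : continuous bump_fun.
Proof.
have := smooth_continuous (@smooth_bump_fun 1 1 0).
by under eq_fun do rewrite scale1r subr0 mul1r.
Qed.

Definition box_segs : seq (R * R * U) :=
  [seq (-1, 1, tnth s i) | i <- enum 'I_d].

Definition mollifier u : R := bump_fun u / boxint box_segs bump_fun 0.

Let mass_gt0 : 0 < boxint box_segs bump_fun 0.
Proof.
apply: boxint_gt0; [exact: bump_fun_continuous|exact: bump_fun_ge0| |exact:
  bump_fun0_gt0].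
by apply/allP => _ /mapP[i _ ->] /=; rewrite ltrN10 ltr01.
Qed.

Lemma mollifier_continuous : continuous mollifier.
Proof.
apply: continuous_funM; [exact: bump_fun_continuous|exact: cst_continuous].
Qed.

Lemma mollifier_ge0 u : 0 <= mollifier u.
Proof. by rewrite divr_ge0 ?bump_fun_ge0// ltW. Qed.

Lemma mollifier_le u : mollifier u <= (boxint box_segs bump_fun 0)^-1.
Proof. by rewrite ler_piMl ?bump_fun_le1// invr_ge0 ltW. Qed.

Lemma mollifier_supp u : mollifier u != 0 -> forall i, `|coord s i u| <= 1.
Proof. by rewrite mulf_eq0 negb_or => /andP[/bump_fun_supp]. Qed.

Lemma mollifierN u : mollifier (- u) = mollifier u.
Proof. by rewrite /mollifier bump_funN. Qed.

Lemma boxint_mollifier : boxint box_segs mollifier 0 = 1.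
Proof.
rewrite (_ : mollifier = fun u => (boxint box_segs bump_fun 0)^-1 * bump_fun u).
  by rewrite boxintZ ?mulVf ?gt_eqF//; exact: bump_fun_continuous.
by apply/funext => u; rewrite mulrC.
Qed.

Lemma smooth_mollifier (c k : R) w : smooth (fun u =>
    c * mollifier (k *: (u - w))).
Proof.
have := @smooth_bump_fun (c / boxint box_segs bump_fun 0) k w.
by under eq_fun do rewrite mulrAC -mulrA.
Qed.

End Bump.

(** * Regularization *)

Section Regularization.
Variables (R : realType) (d : nat) (s : d.-tuple 'rV[R]_d).
Hypothesis s_basis : basis_of fullv s.
Local Notation U := 'rV[R]_d.
Implicit Types (u v w y : U) (phi g : U -> R) (h M : R).

Definition mollifier_at h u y : R := h^-1 ^+ d * mollifier s (h^-1 *: (y - u)).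

(** Evenness of the bump makes centre and variable interchangeable, so integrating over the centre
    is again a convolution with the mollifier. *)
Lemma mollifier_atC h u y : mollifier_at h u y = mollifier_at h y u.
Proof. by rewrite /mollifier_at -mollifierN -scalerN opprB. Qed.

Lemma mollifier_at_smooth h u : smooth (mollifier_at h u).
Proof. exact: smooth_mollifier. Qed.

Lemma mollifier_at_translate h u w y :
    mollifier_at h (u + w) y = mollifier_at h u (y - w).
Proof. by rewrite /mollifier_at opprD addrA addrAC. Qed.

Lemma mollifier_at_continuous2 h : continuous (fun x : U * U =>
    mollifier_at h x.1 x.2).
Proof.
apply: continuous_funM; first exact: cst_continuous.
apply: (@continuous_fun_comp _ _ _ (mollifier s)
  (fun x : U * U => h^-1 *: (x.2 - x.1))); first exact: mollifier_continuous.
apply: continuous_funZ; first exact: cst_continuous.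
by apply: continuous_funB => x; [exact: cvg_snd|exact: cvg_fst].
Qed.

Lemma mollifier_at_ge0 h u y : 0 <= h -> 0 <= mollifier_at h u y.
Proof.
by move=> h0; rewrite mulr_ge0 ?mollifier_ge0// exprn_ge0// invr_ge0.
Qed.

Lemma mollifier_at_le h u y : 0 <= h ->
  mollifier_at h u y <= h^-1 ^+ d * (boxint (box_segs s) (bump_fun s) 0)^-1.
Proof.
by move=> h0; rewrite ler_wpM2l ?mollifier_le// exprn_ge0// invr_ge0.
Qed.

Lemma mollifier_at_supp h u y : 0 < h -> mollifier_at h u y != 0 ->
  forall i, `|coord s i (y - u)| <= h.
Proof.
move=> h0; rewrite mulf_eq0 negb_or => /andP[_ /mollifier_supp ku] i.
have := ku i; rewrite linearZ/= normrM gtr0_norm ?invr_gt0//.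
by rewrite ler_pdivrMl// mulr1.
Qed.

(** The convolution of [phi] with the mollifier of scale [h], the variable being rescaled to a cube
    that does not depend on [h]. *)
Definition smoothing h phi y : R :=
  boxint (box_segs s) (fun v => phi (y + h *: v) * mollifier s v) 0.

Definition supported M phi :=
  forall w, phi w != 0 -> forall i, `|coord s i w| <= M.

Definition cube_segs M : seq (R * R * U) :=
  [seq (- M, M, tnth s i) | i <- enum 'I_d].

Lemma integral_overE g : integral_over s g =
  iterated_integral setT [seq tnth s i | i <- enum 'I_d] g 0.
Proof. by rewrite /integral_over map_tnth_enum. Qed.

Lemma integral_over_supported M g : supported M g ->
  integral_over s g = boxint (cube_segs M) g 0.
Proof.
move=> sg; rewrite integral_overE.
apply: (@iterated_integral_setT_boxint _ _ _ _ (fun=> - M) (fun=> M)) => //.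
- exact: enum_uniq.
- by move=> w gw i _; rewrite -ler_norml; exact: sg.
- by move=> i _; rewrite linear0.
Qed.

(* The right-hand side also makes sense for h = 0. *)
Lemma integral_over_mollifier_at h phi y : 0 < h -> continuous phi ->
  integral_over s (fun w => mollifier_at h y w * phi w) = smoothing h phi y.
Proof.
move=> h0 cphi; rewrite integral_overE.
have ck : continuous (fun w => mollifier_at h y w * phi w).
  by apply: continuous_funM => //;
    exact: smooth_continuous (mollifier_at_smooth h y).
(* The cube of radius [h] around [y] contains the support; its bounds are written in the form that
   [boxint_affine] rescales to [[-1, 1]]. *)
rewrite (@iterated_integral_setT_boxint _ _ _ _ (fun i => coord s i y + h * -1)
  (fun i => coord s i y + h * 1))//; last 3 first.
- exact: enum_uniq.
- move=> w; rewrite mulf_eq0 negb_or => /andP[kw _] i _.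
  by have := mollifier_at_supp h0 kw i;
    rewrite linearB/= ler_distl mulrN !mulr1.
- by move=> i _; rewrite linear0.
have N11 : -1 <= 1 :> R by lra.
have := boxint_affine (enum 'I_d) (tnth s) (fun i => coord s i y) 0 0 ck N11 h0.
rewrite scaler0 addr0 => ->; rewrite size_enum_ord /smoothing.
have -> : 0 + \sum_(i <- enum 'I_d) coord s i y *: tnth s i = y.
  rewrite add0r big_enum [RHS](coord_basis s_basis (memvf y)).
  by apply: eq_bigr => i _; rewrite (tnth_nth 0).
rewrite (_ : (fun x => _) = (fun x => h^-1 ^+ d *
    (phi (y + h *: x) * mollifier s x))); last first.
  apply/funext => x; rewrite /mollifier_at addrAC subrr add0r scalerA.
  by rewrite mulVf ?gt_eqF// scale1r -mulrA (mulrC (phi _)).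
rewrite boxintZ; first by rewrite mulrA -exprMn mulfV ?gt_eqF// expr1n mul1r.
apply: continuous_funM; last exact: mollifier_continuous.
apply: (@continuous_fun_comp _ _ _ phi (fun x : U => y + h *: x) cphi).
apply: continuous_funD; first exact: cst_continuous.
by apply: continuous_funZ; [exact: cst_continuous|exact: continuous_fun_id].
Qed.

Lemma smoothing0 phi : smoothing 0 phi = phi.
Proof.
apply/funext => y; rewrite /smoothing.
under [X in boxint _ X]eq_fun do rewrite scale0r addr0.
by rewrite boxintZ ?boxint_mollifier ?mulr1//; exact: mollifier_continuous.
Qed.

(** Triples of scale, centre and integration variable. On this space the smoothing is an iterated
    integral of a single continuous function, so continuity in the scale, at 0 too, is continuity of
    [boxint]. *)
Let V3 := ((R^o * U) * U)%type.

Let smoothing_fun phi (x : V3) : R :=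
  phi (x.1.2 + x.1.1 *: x.2) * mollifier s x.2.

Let smoothing_fun_continuous phi : continuous phi ->
  continuous (smoothing_fun phi).
Proof.
move=> cphi.
have c11 : continuous (fun x : V3 => x.1.1).
  by move=> x; apply: (@cvg_comp _ _ _ fst fst); exact: cvg_fst.
have c12 : continuous (fun x : V3 => x.1.2).
  by move=> x; apply: (@cvg_comp _ _ _ fst snd);
    [exact: cvg_fst|exact: cvg_snd].
have c2 : continuous (fun x : V3 => x.2) by move=> x; exact: cvg_snd.
apply: continuous_funM.
  apply: (@continuous_fun_comp _ _ _ phi (fun x : V3 =>
    x.1.2 + x.1.1 *: x.2)) => //.
  by apply: continuous_funD => //; exact: continuous_funZ.
by apply: (@continuous_fun_comp _ _ _ (mollifier s) (fun x : V3 => x.2)) => //;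
  exact: mollifier_continuous.
Qed.

Let box_segs3 : seq (R * R * V3) :=
  [seq (x.1, ((0, 0), x.2)) | x <- box_segs s].

Let smoothingE phi h y :
  smoothing h phi y = boxint box_segs3 (smoothing_fun phi) ((h, y), 0).
Proof.
rewrite /box_segs3 (@boxint_comp _ _ _ _ (fun v => ((h, y), v)))//.
move=> x t v _; congr (_, _); rewrite /= !scaler0.
by congr (_, _); rewrite addr0.
Qed.

Lemma smoothing_continuous_param Z phi w : continuous phi ->
  continuous (fun h => boxint (unit_segs Z) (smoothing h phi) w).
Proof.
move=> cphi.
pose Z3 : seq (R * R * V3) := [seq (x.1, ((0, x.2), 0)) | x <- unit_segs Z].
rewrite (_ : (fun h => _) = (fun h =>
  boxint Z3 (boxint box_segs3 (smoothing_fun phi))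
    ((h, w), 0))).
  apply: (@continuous_fun_comp _ _ _ (boxint Z3 (boxint box_segs3
    (smoothing_fun phi)))
    (fun h => ((h, w), 0))).
    by do 2 apply: boxint_continuous; exact: smoothing_fun_continuous.
  apply: continuous_fun_pair; last exact: cst_continuous.
  by apply: continuous_fun_pair;
    [exact: continuous_fun_id|exact: cst_continuous].
apply/funext => h; rewrite /Z3.
rewrite (@boxint_comp _ _ _ _ (fun y => ((h, y), 0)) (fun y => ((0, y), 0)))//.
  by congr (boxint _ _ _); apply/funext => y; rewrite smoothingE.
move=> x t v _; congr (_, _); rewrite /= ?scaler0 ?addr0//.
by congr (_, _); rewrite /= ?scaler0 ?addr0.
Qed.

End Regularization.

(** * Pairing a test function with mollified box splines *)

Section FubiniMollifier.
Variables (R : realType) (d : nat) (s : d.-tuple 'rV[R]_d).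
Hypothesis s_basis : basis_of fullv s.
Local Notation U := 'rV[R]_d.
Implicit Types (u v w y : U) (phi g : U -> R) (h M : R) (Z : seq U)
  (D : seq (R * seq U * U)).

(** Segments in one factor of U * U. Exchanging the integrals over the centre and over the box
    spline then becomes [boxint_boxintC] on the product. *)
Let snd_segs (l : seq (R * R * U)) : seq (R * R * (U * U)%type) :=
  [seq (x.1, (0, x.2)) | x <- l].

Let boxint_snd l (F : U * U -> R) u y :
  boxint (snd_segs l) F (u, y) = boxint l (fun y => F (u, y)) y.
Proof.
rewrite /snd_segs (@boxint_comp _ _ _ _ (fun y => (u, y)))// => x t z _.
by congr (_, _); rewrite /= scaler0 addr0.
Qed.

Let fst_segs (l : seq (R * R * U)) : seq (R * R * (U * U)%type) :=
  [seq (x.1, (x.2, 0)) | x <- l].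

Let boxint_fst l (F : U * U -> R) u y :
  boxint (fst_segs l) F (u, y) = boxint l (fun u => F (u, y)) u.
Proof.
rewrite /fst_segs (@boxint_comp _ _ _ _ (fun u => (u, y)) (fun u => (u, 0)))//.
by move=> x t z _; congr (_, _); rewrite /= scaler0 addr0.
Qed.

Let pair_r_continuous y : continuous (fun u : U => (u, y)).
Proof.
by apply: continuous_fun_pair; [exact: continuous_fun_id|exact: cst_continuous].
Qed.

Lemma mollifier_at_continuous h u : continuous (mollifier_at s h u).
Proof. by apply: smooth_continuous; exact: mollifier_at_smooth. Qed.

Lemma boxint_mollifier_at_continuous h Z w :
  continuous (fun u => boxint (unit_segs Z) (mollifier_at s h u) w).
Proof.
rewrite (_ : (fun u => _) = (fun u => boxint (snd_segs (unit_segs Z))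
    (fun x => mollifier_at s h x.1 x.2) (u, w))).
  apply: continuous_fun_comp; last exact: pair_r_continuous.
  by apply: boxint_continuous; exact: mollifier_at_continuous2.
by apply/funext => u; rewrite boxint_snd.
Qed.

Lemma box_comb_mollifier_at_continuous h D :
  continuous (fun u => box_comb D (mollifier_at s h u)).
Proof.
apply: continuous_fun_sum => q; apply: continuous_funM.
  exact: cst_continuous.
exact: boxint_mollifier_at_continuous.
Qed.

(** After the exchange, the inner integral over the centre u pairs phi with the mollifier, which is
    symmetric in u and y, and is therefore the smoothing of phi at y. *)
Lemma boxint_cube_mollifier_at h Z w phi M : 0 < h -> 0 <= M ->
    continuous phi ->
  supported s M phi ->
  boxint (cube_segs s M) (fun u =>
    phi u * boxint (unit_segs Z) (mollifier_at s h u) w) 0 =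
  boxint (unit_segs Z) (smoothing s h phi) w.
Proof.
move=> h0 M0 cphi sphi.
pose F (x : U * U) := phi x.1 * mollifier_at s h x.1 x.2.
have cF : continuous F.
  apply: continuous_funM; last exact: mollifier_at_continuous2.
  by apply: (@continuous_fun_comp _ _ _ phi fst) => // x; exact: cvg_fst.
have wM : ordered_bounds (fst_segs (cube_segs s M)).
  apply/allP => _ /mapP[_ /mapP[i _ ->] ->] /=; lra.
have wZ : ordered_bounds (snd_segs (unit_segs Z)).
  by apply/allP => _ /mapP[_ /mapP[i _ ->] ->] /=.
transitivity (boxint (fst_segs (cube_segs s M)) (boxint (snd_segs (unit_segs
  Z)) F)
    (0, w)).
  rewrite boxint_fst; congr (boxint _ _ _); apply/funext => u.
  rewrite boxint_snd.
  exact: (esym (congr1 (@^~ w) (boxintZ (unit_segs Z) (phi u)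
    (@mollifier_at_continuous h u)))).
rewrite boxint_boxintC// boxint_snd; congr (boxint _ _ _); apply/funext => y.
rewrite boxint_fst -(integral_over_mollifier_at s_basis y h0 cphi).
rewrite -(integral_over_supported s_basis); last first.
  by move=> u; rewrite /F mulf_eq0 negb_or => /andP[/sphi].
by congr (integral_over _ _); apply/funext => u;
  rewrite /F/= mollifier_atC mulrC.
Qed.

Lemma integral_over_box_comb h D phi M : 0 < h -> 0 <= M -> continuous phi ->
  supported s M phi ->
  integral_over s (fun u => phi u * box_comb D (mollifier_at s h u)) =
  box_comb D (smoothing s h phi).
Proof.
move=> h0 M0 cphi sphi.
rewrite (integral_over_supported s_basis (M := M)); last first.
  by move=> u; rewrite mulf_eq0 negb_or => /andP[/sphi].
rewrite (_ : (fun u => _) = (fun u => \sum_(q <- D) q.1.1 *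
    (phi u * boxint (unit_segs q.1.2) (mollifier_at s h u) q.2))); last first.
  by apply/funext => u; rewrite mulr_sumr; apply: eq_bigr => q _;
    rewrite mulrCA.
have cq (q : R * seq U * U) : continuous
    (fun u => phi u * boxint (unit_segs q.1.2) (mollifier_at s h u) q.2).
  by apply: continuous_funM => //; exact: boxint_mollifier_at_continuous.
rewrite boxint_sum; last first.
  by move=> q; apply: continuous_funM => //; exact: cst_continuous.
by apply: eq_bigr => q _; rewrite boxintZ// boxint_cube_mollifier_at.
Qed.

Lemma box_comb_smoothing_cvg D phi : continuous phi ->
  box_comb D (smoothing s h phi) @[h --> 0] --> box_comb D phi.
Proof.
move=> cphi.
have : continuous (fun h => box_comb D (smoothing s h phi)).
  apply: continuous_fun_sum => q; apply: continuous_funM.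
    exact: cst_continuous.
  exact: smoothing_continuous_param.
by move=> /(_ 0); rewrite /continuous_at smoothing0.
Qed.

End FubiniMollifier.

(** * Lipschitz estimates uniform in the scale *)

Section Lipschitz.
Variables (R : realType) (d : nat) (s : d.-tuple 'rV[R]_d).
Hypothesis s_basis : basis_of fullv s.
Local Notation U := 'rV[R]_d.
Implicit Types (u v w y : U) (phi g : U -> R) (h M t : R) (Z : seq U)
  (D : seq (R * seq U * U)).

(** Sliding the segment by t along itself changes the integral only by two end pieces of length |t|,
    each contributing at most M |t|. *)
Lemma segint_lipschitz v g M w t : continuous g -> (forall u, `|g u| <= M) ->
  `|segint 0 1 v g (w + t *: v) - segint 0 1 v g w| <= 2 * M * `|t|.
Proof.
move=> cg gM.
have cl := @continuous_line _ _ g w v cg.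
have t0 : 0 <= `|t| by [].
have tt : - `|t| <= t <= `|t| by rewrite -ler_norml.
(* This interval contains both [[0, 1]] and [[t, t + 1]], whatever the sign of [t]. *)
have [P dP] := continuous_has_primitive (- `|t|) (1 + `|t|) cl.
have FTC (x y : R) : - `|t| <= x -> x <= y -> y <= 1 + `|t| ->
    \int[lebesgue_measure]_(r in `[x, y]) g (w + r *: v) = P y - P x.
  move=> tx xy yt.
  have dxy (r : R) : r \in `[x, y] -> is_derive r 1 P (g (w + r *: v)).
    rewrite in_itv/= => /andP[xr ry]; apply: dP.
    by rewrite in_itv/= (le_trans tx xr) (le_trans ry yt).
  exact: (Rintegral_FTC2 xy cl dxy).
have PM (x y : R) : - `|t| <= x -> y <= 1 + `|t| -> x <= y ->
    `|P y - P x| <= M * (y - x).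
  move=> tx yt xy; rewrite -FTC//.
  by apply: Rintegral_itv_bound => // r _; exact: gM.
have E1 : segint 0 1 v g w = P 1 - P 0 by rewrite /segint FTC//; lra.
have E2 : segint 0 1 v g (w + t *: v) = P (t + 1) - P t.
  have := @segint_affine _ _ 0 1 t 1 v w g cg ler01 ltr01.
  rewrite mulr0 mulr1 addr0 scale1r mul1r => <-.
  rewrite /segint FTC//; lra.
have M0 : 0 <= M := le_trans (normr_ge0 _) (gM 0).
rewrite E1 E2.
have -> : P (t + 1) - P t - (P 1 - P 0) =
  (P (t + 1) - P 1) - (P t - P 0) by ring.
rewrite (le_trans (ler_normB _ _))//.
have [tge|tlt] := leP 0 t.
  have := PM 1 (t + 1); have := PM 0 t.
  rewrite (ger0_norm tge) => H1 H2.
  have {}H1 : `|P t - P 0| <= M * (t - 0) by apply: H1; lra.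
  have {}H2 : `|P (t + 1) - P 1| <= M * (t + 1 - 1) by apply: H2; lra.
  lra.
have := PM (t + 1) 1; have := PM t 0.
rewrite (ltr0_norm tlt) => H1 H2.
have {}H1 : `|P 0 - P t| <= M * (0 - t) by apply: H1; lra.
have {}H2 : `|P 1 - P (t + 1)| <= M * (1 - (t + 1)) by apply: H2; lra.
rewrite distrC (distrC (P t)); lra.
Qed.

(* The integration along v makes the box spline Lipschitz in that direction;
   the bound is uniform in h because Z still spans. *)
Lemma box_comb_mollifier_at_lipschitz1 D v :
  (forall q, q \in D -> exists2 Z, q.1.2 = v :: Z & <<Z>>%VS = fullv) ->
  exists2 C, 0 <= C & forall h, 0 < h -> forall u t,
    `|box_comb D (mollifier_at s h (u + t *: v)) - box_comb D (mollifier_at s h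
      u)| <=
    C * `|t|.
Proof.
elim: D => [|q D IH] HD.
  exists 0 => // h h0 u t; rewrite /box_comb !big_nil subrr normr0 mul0r//.
have [C C0 HC] : exists2 C, 0 <= C & forall h, 0 < h -> forall u t,
    `|box_comb D (mollifier_at s h (u + t *: v)) - box_comb D (mollifier_at s h
      u)| <=
    C * `|t|.
  by apply: IH => r rD; apply: HD; rewrite inE rD orbT.
have [Z qZ Zs] := HD q (mem_head _ _).
have [K K0 HK] := boxint_spanning_bound s_basis Zs.
pose B := (boxint (box_segs s) (bump_fun s) 0)^-1.
have B0 : 0 <= B.
  by have := le_trans (@mollifier_ge0 _ _ s 0) (mollifier_le _ 0).
pose C' := `|q.1.1| * (2 * (B * K ^+ d)).
exists (C' + C); first by rewrite addr_ge0// !mulr_ge0// exprn_ge0.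
move=> h h0 u t; rewrite /box_comb !big_cons opprD addrACA mulrDl.
rewrite (le_trans (ler_normD _ _))// lerD//; last exact: HC.
rewrite -mulrBr normrM /C' -[leRHS]mulrA ler_wpM2l// qZ.
have ck : continuous (mollifier_at s h u) by exact: mollifier_at_continuous.
(* Moving the centre by [t *: v] is translating the integrand by [- t *: v], hence sliding the
   segment along [v]. *)
have -> : mollifier_at s h (u + t *: v) = (fun y =>
  mollifier_at s h u (y + (- t) *: v)).
  by apply/funext => y; rewrite mollifier_at_translate scaleNr.
rewrite boxint_shift -(normrN t); apply: segint_lipschitz.
  exact: boxint_continuous.
move=> w.
(* The sup bound of the mollifier against the size of its support: the scale cancels. *)
have E : h^-1 ^+ d * B * (K * h) ^+ d = B * K ^+ d.
  transitivity (B * K ^+ d * (h^-1 * h) ^+ d); first by rewrite !exprMn; ring.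
  by rewrite mulVf ?gt_eqF// expr1n mulr1.
rewrite -E; apply: (HK _ _ _ u) => //; first exact: ltW.
- move=> y; rewrite ger0_norm; first exact: mollifier_at_le (ltW h0).
  exact: mollifier_at_ge0 (ltW h0).
- by move=> y; exact: mollifier_at_supp.
Qed.

Lemma coord_norm_bound n (X : n.-tuple U) i :
  exists2 L, 0 <= L & forall w, `|coord X i w| <= L * `|w|.
Proof.
exists (\sum_(j < d) `|coord X i (delta_mx 0 j)|); first exact: sumr_ge0.
move=> w; rewrite [in leLHS](row_sum_delta w) linear_sum/= mulr_suml.
rewrite (le_trans (ler_norm_sum _ _ _))//; apply: ler_sum => j _.
rewrite linearZ/= normrM mulrC ler_wpM2l//.
(* The norm of a row vector is the largest absolute value of its entries. *)
rewrite [leRHS]/Num.norm/= mx_normrE; apply/bigmax_geP; right => /=.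
by exists (0, j).
Qed.

End Lipschitz.

(** * The continuous limit as the scale tends to 0 *)

Section Limit.
Variables (R : realType) (d : nat) (s : d.-tuple 'rV[R]_d).
Hypothesis s_basis : basis_of fullv s.
Local Notation U := 'rV[R]_d.
Implicit Types (u v w y : U) (phi g : U -> R) (h M t : R) (Z : seq U)
  (D : seq (R * seq U * U)).

(** The displacement w is made in steps along the elements of X, whose lengths are the coordinates
    of w and hence bounded by multiples of its norm. The list X may be dependent: [coord] is linear
    and reproduces the vectors of the span in that case too. *)
Lemma lipschitz_of_spanning (X : seq U) (F : R -> U -> R) :
  <<X>>%VS = fullv ->
  (forall x, x \in X -> exists2 C, 0 <= C & forall h, 0 < h -> forall u t,
    `|F h (u + t *: x) - F h u| <= C * `|t|) ->
  exists2 C, 0 <= C & forall h, 0 < h -> forall u w,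
    `|F h (u + w) - F h u| <= C * `|w|.
Proof.
move=> Xs HX; pose Xt := in_tuple X.
(* Writing the displacement as a sum over an index list allows induction on that list, with
   constants chosen before [h]. *)
suff [C C0 HC] : exists2 C, 0 <= C & forall h, 0 < h -> forall u w,
    `|F h (u + \sum_(i <- index_enum 'I_(size X)) coord Xt i w *: Xt`_i) - F h
      u|
    <= C * `|w|.
  exists C => // h h0 u w.
  by rewrite [in F h (u + w)](@coord_span _ _ _ Xt w) ?HC//= Xs memvf.
elim: (index_enum _) => [|i r [C C0 IH]].
  by exists 0 => // h h0 u w; rewrite big_nil addr0 subrr normr0 mul0r.
have [C' C'0 HC'] := HX Xt`_i (mem_nth _ (ltn_ord i)).
have [L L0 HL] := coord_norm_bound Xt i.
exists (C' * L + C); first by rewrite addr_ge0// mulr_ge0.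
move=> h h0 u w; rewrite big_cons.
set S := \sum_(j <- r) _; rewrite addrA mulrDl.
rewrite -(subrK (F h (u + coord Xt i w *: Xt`_i))
  (F h (u + coord Xt i w *: Xt`_i + S))) -addrA addrC.
rewrite (le_trans (ler_normD _ _))// lerD//; last exact: IH.
rewrite (le_trans (HC' _ h0 _ _))// -mulrA ler_wpM2l//.
Qed.

(** The mollifier has mass 1, so the difference is an average of phi (u + h v) - phi u. On the
    support the coordinates of v are at most 1 in absolute value, whence the sum of the norms of the
    s_i as a bound for v. *)
Lemma smoothing_sub_le phi C h u : 0 <= h -> 0 <= C -> continuous phi ->
  (forall u w, `|phi (u + w) - phi u| <= C * `|w|) ->
  `|smoothing s h phi u - phi u| <= C * (\sum_i `|tnth s i|) * h.
Proof.
move=> h0 C0 cphi phiL.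
pose N := \sum_i `|tnth s i|; rewrite -/N.
have cpsi := @mollifier_continuous _ _ s.
have ct : continuous (fun v => phi (u + h *: v) * mollifier s v).
  apply: continuous_funM => //.
  apply: (@continuous_fun_comp _ _ _ phi (fun v : U => u + h *: v) cphi).
  apply: continuous_funD; first exact: cst_continuous.
  by apply: continuous_funZ; [exact: cst_continuous|exact: continuous_fun_id].
have cc c : continuous (fun v => c * mollifier s v).
  by apply: continuous_funM => //; exact: cst_continuous.
have -> : smoothing s h phi u - phi u = boxint (box_segs s)
    (fun v => phi (u + h *: v) * mollifier s v - phi u * mollifier s v) 0.
  by rewrite boxintB// boxintZ// boxint_mollifier mulr1.
have := @boxint_norm_le _ _ (box_segs s)
  (fun v => phi (u + h *: v) * mollifier s v - phi u * mollifier s v)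
  (fun v => C * N * h * mollifier s v) 0.
rewrite boxintZ// boxint_mollifier mulr1; apply => //.
  exact: continuous_funB.
move=> v; rewrite -mulrBl normrM (ger0_norm (mollifier_ge0 s v)).
have [->|/mollifier_supp vs] := eqVneq (mollifier s v) 0;
  first by rewrite !mulr0.
rewrite ler_wpM2r ?mollifier_ge0// (le_trans (phiL _ _))// -mulrA ler_wpM2l//.
rewrite normrZ ger0_norm// mulrC ler_wpM2r//.
rewrite [in leLHS](coord_basis s_basis (memvf v)).
rewrite (le_trans (ler_norm_sum _ _ _))//; apply: ler_sum => i _.
by rewrite normrZ (tnth_nth 0) ler_piMl.
Qed.

Lemma test_function_supported phi : test_function phi ->
  exists2 M, 0 <= M & supported s M phi.
Proof.
move=> [_ cK].
have [M [_ HM]] := compact_bounded cK.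
have /choice[L HL] : forall i, exists L, 0 <= L /\
    forall w, `|coord s i w| <= L * `|w|.
  by move=> i; have [L L0 HL] := coord_norm_bound s i; exists L.
have M1 : M < `|M| + 1 by rewrite (le_lt_trans (ler_norm M))// ltrDl.
exists (\sum_i L i * (`|M| + 1)).
  by apply: sumr_ge0 => i _; rewrite mulr_ge0 ?(HL i).1// addr_ge0.
move=> w pw i; apply: (le_trans ((HL i).2 w)).
apply: (@le_trans _ _ (L i * (`|M| + 1))).
  rewrite ler_wpM2l ?(HL i).1//; apply: (HM _ M1).
  exact: subset_closure.
rewrite (bigD1 i)//= lerDl; apply: sumr_ge0 => j _.
by rewrite mulr_ge0 ?(HL j).1// addr_ge0.
Qed.

Lemma integral_over_dist_le phi M f g e : 0 <= M -> continuous phi ->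
  supported s M phi -> continuous f -> continuous g ->
  (forall u, `|f u - g u| <= e) ->
  `|integral_over s (fun u => phi u * f u) -
    integral_over s (fun u => phi u * g u)| <=
  boxint (cube_segs s M) (fun u => `|phi u|) 0 * e.
Proof.
move=> M0 cphi sphi cf cg fg.
have sM f' : supported s M (fun u => phi u * f' u).
  by move=> w; rewrite mulf_eq0 negb_or => /andP[/sphi].
rewrite !(integral_over_supported s_basis (sM _)).
have cpf f' : continuous f' -> continuous (fun u => phi u * f' u).
  by move=> cf'; exact: continuous_funM.
have cn : continuous (fun u => `|phi u|).
  by move=> u; exact: (cvg_norm (cphi u)).
have cen : continuous (fun u => e * `|phi u|).
  by apply: continuous_funM => //; exact: cst_continuous.
have E1 := congr1 (@^~ 0) (boxintB (cube_segs s M) (cpf _ cf) (cpf _ cg)).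
have E2 := congr1 (@^~ 0) (boxintZ (cube_segs s M) e cn).
rewrite -[X in `|X|]E1 mulrC -[leRHS]E2.
apply: boxint_norm_le => //; first by apply: continuous_funB; exact: cpf.
by move=> u; rewrite -mulrBr normrM mulrC ler_wpM2r.
Qed.

Variables (D : seq (R * seq U * U)) (C : R).
Hypothesis C0 : 0 <= C.
Hypothesis D_lipschitz : forall h, 0 < h -> forall u w,
  `|box_comb D (mollifier_at s h (u + w)) - box_comb D (mollifier_at s h u)| <=
    C * `|w|.

Let F (n : nat) u := box_comb D (mollifier_at s n.+1%:R^-1 u).

Let cF n : continuous (F n).
Proof. exact: box_comb_mollifier_at_continuous. Qed.

Let h_gt0 n : 0 < n.+1%:R^-1 :> R.
Proof. by rewrite invr_gt0. Qed.

(** By Fubini the integral is [box_comb D] applied to the smoothing of phi at scale 1 / (n + 1),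
    which is continuous in the scale at 0. *)
Let F_weak_cvg phi M : 0 <= M -> continuous phi -> supported s M phi ->
  integral_over s (fun u => phi u * F n u) @[n --> \oo] --> box_comb D phi.
Proof.
move=> M0 cphi sphi.
rewrite (_ : (fun n => _) = (fun h => box_comb D (smoothing s h phi)) \o
    (fun n => n.+1%:R^-1)).
  have hc : (fun n : nat => n.+1%:R^-1 : R) @ \oo --> 0 by exact: cvg_harmonic.
  exact: (cvg_comp _ _ hc (@box_comb_smoothing_cvg _ _ s D _ cphi)).
apply/funext => n; rewrite /F.
by rewrite (integral_over_box_comb s_basis D (h_gt0 n) M0 cphi sphi).
Qed.

Let A := C * \sum_i `|tnth s i|.

(* The integral of F n against the mollifier of scale 1 / k.+1 at u differs from
   F n u by at most A / k.+1, and converges to F k u as n grows. *)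
Let F_near k u e : 0 < e ->
  \forall n \near \oo, `|F n u - F k u| <= A * k.+1%:R^-1 + e.
Proof.
move=> e0; pose h : R := k.+1%:R^-1.
have h0 : 0 < h by exact: h_gt0.
have [M M0 sM] : exists2 M, 0 <= M & supported s M (mollifier_at s h u).
  exists (h + \sum_i `|coord s i u|).
    by apply: addr_ge0; [exact: ltW|exact: sumr_ge0].
  move=> w /(mollifier_at_supp h0) kw i; rewrite -(subrK u w) linearD/=.
  rewrite (le_trans (ler_normD _ _))// lerD//.
  by rewrite (bigD1 i)//= lerDl sumr_ge0.
have := F_weak_cvg M0 (@mollifier_at_continuous _ _ _ _ _) sM.
move=> /cvgrPdist_le/(_ _ e0); apply: filterS => n.
rewrite (integral_over_mollifier_at s_basis u h0 (@cF n)) -/(F k u) => H.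
have S := smoothing_sub_le u (ltW h0) C0 (@cF n) (D_lipschitz (h_gt0 n)).
rewrite -(subrK (smoothing s h (F n) u) (F n u)) -addrA.
rewrite (le_trans (ler_normD _ _))// lerD//.
  by rewrite distrC; exact: S.
by rewrite distrC.
Qed.

Let F_cvg u : cvg (F n u @[n --> \oo]).
Proof.
apply/cauchy_cvgP/cauchy_exP => e e0.
have e2 : 0 < e / 2 by rewrite divr_gt0.
have [k Hk] : exists k : nat, A * k.+1%:R^-1 < e / 2.
  (* With this [k] the Lipschitz error is below [e / 2]; the rest of [e / 2] is the tolerance given
     to [F_near] below. *)
  exists (Num.truncn (A / (e / 2))).
  rewrite ltr_pdivrMr// mulrC -ltr_pdivrMr//.
  exact: truncnS_gt.
exists (F k u).
have e4 : 0 < e / 2 - A * k.+1%:R^-1 by rewrite subr_gt0.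
have := F_near k u e4; apply: filterS => n Hn.
rewrite /ball/= distrC (le_lt_trans Hn)// addrC subrK; lra.
Qed.

Let f u := lim (F n u @[n --> \oo]).

(** Passing to the limit in n in [F_near]. The bound does not depend on u, so the convergence to f
    is uniform. *)
Let f_dist k u : `|f u - F k u| <= A * k.+1%:R^-1.
Proof.
apply/ler_addgt0Pr => e e0.
have cv : `|F n u - F k u| @[n --> \oo] --> `|f u - F k u|.
  apply: cvg_norm; apply: cvgB; [exact: F_cvg|exact: cvg_cst].
exact: (cvgr_to_le cv (F_near k u e0)).
Qed.

Let f_continuous : continuous f.
Proof.
move=> u; apply: (@cvgrPdist_le _ _ _ (nbhs u) (nbhs_filter u) f (f u)).2 =>
  e e0.
(* The Lipschitz constant [C] passes to the limit, but may be 0; [C + 1] can be divided by. *)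
have C1 : 0 < C + 1 by rewrite ltr_wpDl.
have fl w : `|f (u + w) - f u| <= C * `|w|.
  have cv : `|F n (u + w) - F n u| @[n --> \oo] --> `|f (u + w) - f u|.
    by apply: cvg_norm; apply: cvgB; exact: F_cvg.
  apply: (cvgr_to_le cv); by apply: nearW => n; exact: D_lipschitz.
apply/nbhs_ballP; exists (e / (C + 1)); first by rewrite /= divr_gt0.
move=> w; rewrite -ball_normE /= => uw; rewrite distrC.
have := fl (w - u); rewrite [u + _]addrC subrK => /le_trans; apply.
rewrite (@le_trans _ _ ((C + 1) * `|w - u|))//.
  by rewrite ler_wpM2r// lerDl.
by rewrite mulrC -ler_pdivlMr// distrC ltW.
Qed.

(** The integrals of phi against [F n] have two limits, which must agree: the functional at phi by
    weak convergence, and the integral against f by uniform convergence on the support of phi. *)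
Lemma box_comb_represented : exists f, continuous f /\
  forall phi M, 0 <= M -> continuous phi -> supported s M phi ->
    integral_over s (fun u => phi u * f u) = box_comb D phi.
Proof.
exists f; split=> // phi M M0 cphi sphi.
apply: (@cvg_unique _ _ (integral_over s (fun u =>
  phi u * F n u) @[n --> \oo])) => //;
  last exact: F_weak_cvg sphi.
apply/cvgrPdist_le => e e0.
pose B := boxint (cube_segs s M) (fun u => `|phi u|) 0.
have : B * (A * n.+1%:R^-1) @[n --> \oo] --> B * (A * 0).
  by do 2 (apply: cvgMr); exact: cvg_harmonic.
rewrite !mulr0 => /cvgrPdist_le/(_ _ e0); apply: filterS => n Hn.
apply: le_trans (integral_over_dist_le M0 cphi sphi f_continuous (@cF n)
  (f_dist n)) _.
by move: Hn; rewrite sub0r normrN; apply: le_trans; exact: ler_norm.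
Qed.

End Limit.

Theorem proposition1 (R : realType) (d : nat) (d_ge1 : (1 <= d)%N)
    (L : set 'rV[R]_d) (s : d.-tuple 'rV[R]_d) (s_basis : lattice_basis L s)
    (X : seq 'rV[R]_d) (X_in_L : forall x, x \in X -> L x)
    (X_spans : <<X>>%VS = {: 'rV[R]_d}%VS)
    (X_unimodular : totally_unimodular L X)
    (p : mpoly d R) (p_internal : internal_space s X p) :
  exists f : 'rV[R]_d -> R,
    continuous f /\ represented_by s (distr_diffop s p (box_spline X)) f.
Proof.
have [sb _] := s_basis.
(* Membership in the internal space gives information only through elements of [X]; one exists
   because [X] spans a space of positive dimension. *)
have [x0 x0X] : exists x, x \in X.
  case: X X_spans {X_in_L X_unimodular p_internal} => [|x X] Xs.
    by move: d_ge1; rewrite -(vector.size_basis sb) -Xs span_nil dimv0.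
  by exists x; exact: mem_head.
have [D [DX DE]] := distr_diffop_box_comb sb p_internal x0X.
have [C C0 HC] : exists2 C, 0 <= C & forall h, 0 < h -> forall u w,
    `|box_comb D (mollifier_at s h (u + w)) - box_comb D (mollifier_at s h u)|
      <= C * `|w|.
  apply: lipschitz_of_spanning X_spans _ => x xX.
  have [D' [D'X D'E]] := distr_diffop_box_comb sb p_internal xX.
  have [C C0 HC] := box_comb_mollifier_at_lipschitz1 sb D'X.
  (* [D] comes from [x0] and [D'] from [x], but both compute p(D) B_X on smooth functions, in
     particular on mollifiers. The fixed [D] thus inherits the bound in every direction [x]. *)
  have E h u : box_comb D (mollifier_at s h u) =
    box_comb D' (mollifier_at s h u).
    by rewrite -(DE _ (@mollifier_at_smooth _ _ s h u)) D'E//;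
      exact: mollifier_at_smooth.
  by exists C => // h h0 u t; rewrite !E; exact: HC.
have [f [cf Hf]] := box_comb_represented sb C0 HC.
exists f; split=> // phi tphi; have [sphi _] := tphi.
have [M M0 sM] := test_function_supported s tphi.
by rewrite DE// -(Hf phi M M0 (smooth_continuous sphi) sM).
Qed.
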